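(* Let $\Omega\subseteq\mathbb R^2$ be an open bounded set and let $r=1/h(\Omega)$. Assume that the maximal Cheeger set $E$ in $\Omega$ contains a ball $B_r(x_0)$, and let $\gamma:[0,1]\to\Omega$ be a $C^{1,1}$ curve, with curvature bounded by $h(\Omega)$, such that $\gamma(0)=x_0$ and $B_r(\gamma(t))\subseteq\Omega$ for all $t\in[0,1]$. Then $B_r(\gamma(t))\subseteq E$ for all $t\in[0,1]$.
   Context: For a Borel set $F\subseteq\mathbb R^2$, $|F|$ is its Lebesgue measure and $P(F)=\sup\{\int_F \mathrm{div}\,g:\ g\in C^1_c(\mathbb R^2;\mathbb R^2),\ |g|\le 1\}$ its perimeter. The Cheeger constant of a bounded open set $\Omega$ is $h(\Omega)=\inf\{P(F)/|F|:\ F\subseteq\Omega,\ |F|>0\}$, and a set $E\subseteq\Omega$ attaining the infimum is a Cheeger set in $\Omega$. Sets of finite perimeter are considered up to Lebesgue null sets, so inclusions involving Cheeger sets are understood up to null sets. The maximal Cheeger set in $\Omega$ is the (unique, always existing) Cheeger set in $\Omega$ that contains every other Cheeger set in $\Omega$. $B_r(x)$ is the open ball of center $x$ and radius $r$. Curves whose curvature is considered are regular ($\gamma'\ne 0$); for a $C^{1,1}$ curve the curvature is defined almost everywhere. *)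

(* Defs.v *)
From HB Require Import structures.
From mathcomp Require Import all_boot all_order all_algebra.
From mathcomp Require Import all_classical all_reals all_analysis.

Set Implicit Arguments.
Unset Strict Implicit.
Unset Printing Implicit Defensive.

Import Order.TTheory GRing.Theory Num.Theory.
Import numFieldNormedType.Exports.

Local Open Scope classical_set_scope.
Local Open Scope ring_scope.

(* [R * R] carries the topology and the derivatives; the convertible type
   [mplane R] carries the sigma-algebra on which [lebesgue_measure] lives.
   Since [R] is second countable, the product sigma-algebra is the Borel one. *)
Notation mplane R := (measurableTypeR R * measurableTypeR R)%type.

Notation leb2 R :=
  (product_measure1 (@lebesgue_measure R) (@lebesgue_measure R)).

Definition borel2 (R : realType) (F : set (R * R)) : Prop :=
  measurable (F : set (mplane R)).

Definition area (R : realType) (F : set (R * R)) : \bar R := leb2 R F.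

Definition ae_subset (R : realType) (A B : set (R * R)) : Prop :=
  area (A `\` B) = 0%E.

(* The library's norm and balls on [R * R] are those of the sup norm, hence
   explicit Euclidean ones; the topology and the bounded sets are the same. *)
Definition enorm (R : realType) (p : R * R) : R :=
  Num.sqrt (p.1 ^+ 2 + p.2 ^+ 2).

Definition eball (R : realType) (x : R * R) (r : R) : set (R * R) :=
  [set y | enorm (y - x) < r].

Definition e1 (R : realType) : R * R := (1, 0).
Definition e2 (R : realType) : R * R := (0, 1).
Arguments e1 {R}.
Arguments e2 {R}.

Definition divergence (R : realType) (g : R * R -> R * R) (p : R * R) : R :=
  ('D_e1 g p).1 + ('D_e2 g p).2.

Definition C1 (R : realType) (g : R * R -> R * R) : Prop :=
  [/\ forall p, derivable g p e1, forall p, derivable g p e2,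
      continuous (fun p => 'D_e1 g p) & continuous (fun p => 'D_e2 g p)].

Definition compactly_supported (R : realType) (g : R * R -> R * R) : Prop :=
  exists2 K : set (R * R), compact K & forall p, ~ K p -> g p = 0.

Definition perimeter (R : realType) (F : set (R * R)) : \bar R :=
  ereal_sup [set (\int[leb2 R]_(p in (F : set (mplane R)))
                    (divergence g p)%:E)%E
    | g in [set g | [/\ C1 g, compactly_supported g
                      & forall p, enorm (g p) <= 1]]].

Definition cheeger_ratio (R : realType) (F : set (R * R)) : \bar R :=
  (perimeter F / area F)%E.

Definition cheeger_const (R : realType) (Omega : set (R * R)) : \bar R :=
  ereal_inf [set cheeger_ratio F
    | F in [set F | [/\ borel2 F, F `<=` Omega & (0 < area F)%E]]].

Definition cheeger_set (R : realType) (Omega E : set (R * R)) : Prop :=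
  [/\ borel2 E, ae_subset E Omega, (0 < area E)%E
    & cheeger_ratio E = cheeger_const Omega].

Definition maximal_cheeger_set (R : realType) (Omega E : set (R * R)) : Prop :=
  cheeger_set Omega E /\ forall F, cheeger_set Omega F -> ae_subset F E.

(* Curves are total functions on [R] of which only the values on [0, 1] matter:
   derivatives are relative to [0, 1], so one-sided at 0 and 1. *)
Definition derivable01 (R : realType) (V : normedModType R) (f : R -> V)
    (t : R) : Prop :=
  cvg ((s - t)^-1 *: (f s - f t) @[s --> within `[0, 1] t^']).

Definition velocity (R : realType) (V : normedModType R) (f : R -> V)
    (t : R) : V :=
  lim ((s - t)^-1 *: (f s - f t) @[s --> within `[0, 1] t^']).

Definition C11_curve (R : realType) (gamma : R -> R * R) : Prop :=
  (forall t : R, t \in `[0, 1] -> derivable01 gamma t) /\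
  exists k : R, k.-lipschitz_(`[0, 1]) (velocity gamma).

Definition regular_curve (R : realType) (gamma : R -> R * R) : Prop :=
  forall t : R, t \in `[0, 1] -> velocity gamma t <> 0.

Definition curvature (R : realType) (gamma : R -> R * R) (t : R) : R :=
  let v := velocity gamma t in
  let a := velocity (velocity gamma) t in
  `|v.1 * a.2 - v.2 * a.1| / enorm v ^+ 3.

(* The second derivative of a C^{1,1} curve exists almost everywhere, so the
   arbitrary values of [curvature] elsewhere are irrelevant here. *)
Definition curvature_bounded_by (R : realType) (gamma : R -> R * R) (k : R) :
    Prop :=
  {ae @lebesgue_measure R,
    forall t : R, t \in `[0, 1] -> curvature gamma t <= k}.

(* Main.v *)
Require Import Defs.
From HB Require Import structures.
From mathcomp Require Import all_boot all_order all_algebra.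
From mathcomp Require Import all_classical all_reals all_analysis.
From mathcomp Require Import measurable_realfun.
From mathcomp Require Import ring lra.
Import Order.TTheory GRing.Theory Num.Theory.
Import numFieldNormedType.Exports.
Local Open Scope classical_set_scope.
Local Open Scope ring_scope.

Set Implicit Arguments.
Unset Strict Implicit.
Unset Printing Implicit Defensive.

(** A Borel set F satisfies P(F) <= h |F| as soon as the integral over F of the
    divergence of every admissible field is at most h |F|, and E satisfies
    these inequalities because it is a Cheeger set.  If T is the union of E and
    of all the discs of radius r = 1/h centred on the curve up to time t, it
    suffices to prove P(T) <= h |T|: then T, which lies in Omega up to a null
    set, is a Cheeger set, hence T is contained in E by maximality
    ([cheeger_set_of_perimeter_bound], [perimeter_bound_of_cheeger_set]).

    The heart is the effect of adding one disc B to a set F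
    ([perimeter_bound_add_ball]).  Let c be the centre of B, x = p - c and
    X(p) = x (3 / (2 r) - |x|^2 / (2 r^3)).  This polynomial field has norm at
    most 1 in B, it is the unit normal on the boundary of B, and its divergence
    3 / r - 2 |x|^2 / r^3 equals 1 / r there.  Given an admissible field g and a
    cutoff phi of B, the field G = (1 - phi) g + phi X is again admissible.
    Testing F with G, and using that div (G - g) has integral zero, bounds the
    integral of div g over F plus that of phi div g over the complement of F by
    the integral of div G over F plus that of
      phi div X + grad phi . (X - g)
    over the complement.  As phi tends to the indicator of B, the contribution
    of the second term tends to zero, because grad phi is a nonpositive multiple
    of x and x . (g - X) <= (r / 2) (1 - |x|^2 / r^2)^2 vanishes to second order
    on the boundary of B, where grad phi concentrates.  The contribution of the
    first is at most k |B \ F| when div X <= k on B \ F.  This is the submodularity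
    of the perimeter together with a calibration of B, both carried out on the
    test fields.

    If F contains the disc of radius r whose centre is at distance at most d
    from c, then B \ F lies in a thin layer near the boundary of B, where
    div X <= 1 / r + O(d).  So a bound P(F) <= A + k |F| with k = 1 / r + O(d)
    passes from F to its union with B.  Constants A and k do not change, hence
    the bound passes to the union with any chain of discs whose centres move by
    at most d at each step ([perimeter_bound_roll]), and the total loss with
    respect to the slope 1 / r is O(d) times the added area, whatever the number
    of discs.  For finer and finer subdivisions of the curve d tends to 0, and
    dominated convergence gives P(T) <= |T| / r ([perimeter_bound_path]). *)

(** * Bounded measurable functions of bounded support on the plane *)

Section plane_measure.
Context {R : realType}.
Implicit Types (U A F : set (R * R)) (f g : R * R -> R).

(** An open set is the union of the countably many rational squares that it
    contains, and a square is a product of two intervals. *)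
Lemma open_borel2 U : open U -> borel2 U.
Proof.
move=> oU.
pose sq (i : rat * rat * rat) : set (R * R) :=
  `]ratr i.1.1 - ratr i.2, ratr i.1.1 + ratr i.2[%classic `*`
  `]ratr i.1.2 - ratr i.2, ratr i.1.2 + ratr i.2[%classic.
have -> : U = \bigcup_i (if `[< sq i `<=` U >] then sq i else set0).
  apply/seteqP; split => [p Up|p [i _]]; last first.
    by case: asboolP => // sU /sU.
  have /nbhs_ballP[e /= e0 eU] : nbhs p U by exact: open_nbhs_nbhs.
  have [c] : exists q : rat, ratr q \in `]0, (e / 2)[.
    by apply: rat_in_itvoo; rewrite divr_gt0.
  rewrite in_itv/= => /andP[c0 ce].
  have [a] : exists q : rat, ratr q \in `]p.1 - ratr c, (p.1 + ratr c)[.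
    by apply: rat_in_itvoo; rewrite ltrD2l gtrN.
  have [b] : exists q : rat, ratr q \in `]p.2 - ratr c, (p.2 + ratr c)[.
    by apply: rat_in_itvoo; rewrite ltrD2l gtrN.
  rewrite !in_itv/= => /andP[b1 b2] /andP[a1 a2].
  exists (a, b, c) => //; case: asboolP => [_|[]].
    by split; rewrite /= in_itv/=; apply/andP; split; lra.
  move=> q [/=]; rewrite !in_itv/= => /andP[q1 q2] /andP[q3 q4]; apply: eU.
  by split; rewrite /ball/= ltr_norml; apply/andP; split; lra.
apply: countable_bigcupT_measurable; first exact: countableP.
move=> i; case: asboolP => _; last exact: measurable0.
by apply: measurableX; exact: measurable_itv.
Qed.

Lemma continuous_measurable2 f :
  continuous f -> measurable_fun [set: mplane R] (f : mplane R -> R).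
Proof.
move=> cf; apply: (measurability _ (measurable_realfun.RGenOpens.measurableE R)).
move=> _ [_ [a [b ->]] <-]; rewrite setTI.
by apply: open_borel2; move/continuousP: cf; apply; exact: interval_open.
Qed.

Definition square (M : R) : set (R * R) :=
  [set p | `|p.1| <= M /\ `|p.2| <= M].

Lemma squareE M : square M = `[- M, M]%classic `*` `[- M, M]%classic.
Proof.
by apply/seteqP; split=> p [/=]; rewrite !in_itv/= -!ler_norml.
Qed.

Lemma borel2_square M : borel2 (square M).
Proof. by rewrite squareE; apply: measurableX; exact: measurable_itv. Qed.

Lemma area_square M : (area (square M) < +oo)%E.
Proof.
rewrite /area squareE product_measure1E; [|exact: measurable_itv..].
have lt_oo : (@lebesgue_measure R `[(- M)%R, M]%classic < +oo)%E.
  have := @lebesgue_measure_itv R `[- M, M]%R.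
  by case: ifPn => _ -> //; rewrite ltry.
by rewrite lte_mul_pinfty// ge0_fin_numE.
Qed.

(** A class closed under the ring operations whose members are all integrable:
    it spares an integrability proof for each integrand below.  The constant M
    serves both as a bound and as a half-side of the support. *)
Definition bounded_measurable f : Prop :=
  measurable_fun [set: mplane R] (f : mplane R -> R) /\
  exists M, forall p, `|f p| <= M /\ (~ square M p -> f p = 0).

Lemma bounded_measurable_integrable f : bounded_measurable f ->
  (leb2 R).-integrable [set: mplane R] (EFin \o (f : mplane R -> R)).
Proof.
move=> [mf [M fM]].
have ->: EFin \o f = (EFin \o f) \_ (square M).
  apply/funext => p; rewrite patchE; case: ifPn => // /negP.
  by rewrite inE /= => /(fM p).2 ->.
have mS := borel2_square M.
apply: (integrable_mkcond (mu := leb2 R) (EFin \o f) mS).1.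
apply: measurable_bounded_integrable => //.
- exact: area_square.
- exact: measurable_funTS.
- exists M; split; first exact: num_real.
  by move=> N MN p _ /=; rewrite (le_trans (fM p).1)// ltW.
Qed.

Lemma bounded_measurableD f g : bounded_measurable f -> bounded_measurable g ->
  bounded_measurable (fun p => f p + g p).
Proof.
move=> [mf [M fM]] [mg [N gN]]; split; first exact: measurable_funD.
have M0 : 0 <= M by rewrite (le_trans _ (fM 0).1).
have N0 : 0 <= N by rewrite (le_trans _ (gN 0).1).
exists (M + N) => p; split.
  by rewrite (le_trans (ler_normD _ _))// lerD// ?(fM p).1 ?(gN p).1.
move=> pMN; rewrite (fM p).2 ?(gN p).2 ?addr0// => -[p1 p2];
  by apply: pMN; split; lra.
Qed.

Lemma bounded_measurableM f g : bounded_measurable f -> bounded_measurable g ->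
  bounded_measurable (fun p => f p * g p).
Proof.
move=> [mf [M fM]] [mg [N gN]]; split; first exact: measurable_funM.
have M0 : 0 <= M by rewrite (le_trans _ (fM 0).1).
have N0 : 0 <= N by rewrite (le_trans _ (gN 0).1).
exists (M + M * N) => p; split.
  rewrite normrM; have := (fM p).1; have := (gN p).1; have := normr_ge0 (f p).
  have := normr_ge0 (g p); nra.
have MN0 := mulr_ge0 M0 N0.
by move=> pMN; rewrite (fM p).2 ?mul0r// => -[p1 p2]; apply: pMN; split; lra.
Qed.

Lemma bounded_measurableZ k f : bounded_measurable f ->
  bounded_measurable (fun p => k * f p).
Proof.
move=> [mf [M fM]]; split; first exact: measurable_funM.
have M0 : 0 <= M by rewrite (le_trans _ (fM 0).1).
have kM0 : 0 <= `|k| * M by rewrite mulr_ge0.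
exists (M + `|k| * M) => p; split.
  rewrite normrM; have := (fM p).1; have := normr_ge0 (f p).
  have := normr_ge0 k; nra.
by move=> pMN; rewrite (fM p).2 ?mulr0// => -[p1 p2]; apply: pMN; split; lra.
Qed.

Lemma bounded_measurableB f g : bounded_measurable f -> bounded_measurable g ->
  bounded_measurable (fun p => f p - g p).
Proof.
move=> mf /(bounded_measurableZ (-1)) /(bounded_measurableD mf).
by under eq_fun do rewrite mulN1r.
Qed.

Lemma bounded_measurable_norm f : bounded_measurable f ->
  bounded_measurable (fun p => `|f p|).
Proof.
move=> [mf [M fM]]; split; first exact: measurableT_comp.
exists M => p; rewrite normr_id; split; first exact: (fM p).1.
by move=> /(fM p).2 ->; rewrite normr0.
Qed.

Lemma bounded_measurable_indic A M : borel2 A -> A `<=` square M ->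
  bounded_measurable (\1_A : R * R -> R).
Proof.
move=> mA AM; split; first exact: (@measurable_indic _ (mplane R)).
exists (Num.max 1 M) => p; split.
  by rewrite indicE; case: (_ \in _); rewrite ?normr1 ?normr0 le_max ?lexx ?ler01.
move=> pM; rewrite indicE memNset// => /AM[p1 p2]; apply: pM.
by split; rewrite le_max (p1, p2) ?orbT.
Qed.

Lemma bounded_measurable_continuous f M : continuous f ->
  (forall p, ~ square M p -> f p = 0) -> bounded_measurable f.
Proof.
move=> cf fM; split; first exact: continuous_measurable2.
have cS : compact (square M).
  by rewrite squareE; apply: compact_setX; exact: segment_compact.
have [N fN] : exists N, forall p, square M p -> `|f p| <= N.
  have /compact_bounded[N [_ fN]] : compact (f @` square M).
    by apply: continuous_compact => //; exact: continuous_subspaceT.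
  by exists (N + 1) => p Mp; apply: (fN (N + 1)); [rewrite ltrDl | exists p].
exists (Num.max (Num.max 0 N) M) => p; split.
  have [/fN fp|/fM ->] := pselect (square M p); last first.
    by rewrite normr0 !le_max lexx.
  by rewrite !le_max fp orbT.
move=> pM; apply: fM => -[p1 p2]; apply: pM.
by split; rewrite !le_max (p1, p2) !orbT.
Qed.

Definition int2 f : R := \int[leb2 R]_(p in [set: mplane R]) f p.

Lemma int2D f g : bounded_measurable f -> bounded_measurable g ->
  int2 (fun p => f p + g p) = int2 f + int2 g.
Proof.
by move=> bf bg; apply: RintegralD => //; exact: bounded_measurable_integrable.
Qed.

Lemma int2B f g : bounded_measurable f -> bounded_measurable g ->
  int2 (fun p => f p - g p) = int2 f - int2 g.
Proof.
by move=> bf bg; apply: RintegralB => //; exact: bounded_measurable_integrable.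
Qed.

Lemma int2Z k f : bounded_measurable f ->
  int2 (fun p => k * f p) = k * int2 f.
Proof.
by move=> bf; apply: RintegralZl => //; exact: bounded_measurable_integrable.
Qed.

Lemma le_int2 f g : bounded_measurable f -> bounded_measurable g ->
  (forall p, f p <= g p) -> int2 f <= int2 g.
Proof.
by move=> bf bg fg; apply: le_Rintegral => //; exact: bounded_measurable_integrable.
Qed.

Lemma int2_EFin f : bounded_measurable f ->
  (\int[leb2 R]_(p in [set: mplane R]) (f p)%:E)%E = (int2 f)%:E.
Proof.
move=> bf; rewrite /int2 /Rintegral fineK//; apply: integrable_fin_num => //.
exact: bounded_measurable_integrable.
Qed.

Lemma int2_indic A : borel2 A -> (area A < +oo)%E -> (int2 \1_A)%:E = area A.
Proof.
move=> mA Afin; rewrite /int2 /Rintegral integral_indic// setIT fineK//.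
by rewrite ge0_fin_numE.
Qed.

Lemma bounded_measurable_restrict A f : borel2 A -> bounded_measurable f ->
  bounded_measurable (fun p => \1_A p * f p).
Proof.
move=> mA [mf [M fM]]; split.
  by apply: measurable_funM => //; exact: (@measurable_indic _ (mplane R)).
exists M => p; rewrite indicE; split; last by move=> /(fM p).2 ->; rewrite mulr0.
case: (_ \in _); rewrite ?mul1r ?mul0r ?(fM p).1//.
by rewrite normr0 (le_trans _ (fM p).1).
Qed.

Lemma integral_int2 A f : borel2 A -> bounded_measurable f ->
  (\int[leb2 R]_(p in (A : set (mplane R))) (f p)%:E)%E =
  (int2 (fun p => \1_A p * f p))%:E.
Proof.
move=> mA bf; rewrite -int2_EFin; last exact: bounded_measurable_restrict.
rewrite [LHS]integral_mkcond; apply: eq_integral => p _; rewrite patchE indicE.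
by case: ifPn => _; rewrite ?mul1r ?mul0r.
Qed.

Lemma cvg_int2 (f_ : nat -> R * R -> R) f g :
  (forall n, bounded_measurable (f_ n)) -> bounded_measurable g ->
  bounded_measurable f ->
  (forall n p, `|f_ n p| <= g p) -> (forall p, f_ n p @[n --> \oo] --> f p) ->
  int2 (f_ n) @[n --> \oo] --> int2 f.
Proof.
move=> bf_ bg bf fg f_f.
have [|||||_ _ cv] := @dominated_convergence _ (mplane R) R (leb2 R) setT
  measurableT (fun n p => (f_ n p)%:E) (EFin \o f) (EFin \o g).
- by move=> n; apply/measurable_EFinP; exact: (bf_ n).1.
- by apply/measurable_EFinP; exact: bf.1.
- apply: aeW => p _ /=; apply: cvg_EFin; last exact: f_f.
  by apply: nearW => n.
- exact: bounded_measurable_integrable.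
- by apply: aeW => p n _ /=; rewrite lee_fin fg.
apply: fine_cvg; rewrite -int2_EFin//; exact: cv.
Qed.

End plane_measure.

(** * Functions of two variables with continuous partial derivatives *)

Section partials.
Context {R : realType}.
Implicit Types (f g : R * R -> R) (p v : R * R).

Lemma is_derive_cvgP (V W : normedModType R) (f : V -> W) (x v : V) (d : W) :
  is_derive x v f d <->
  h^-1 *: (f (h *: v + x) - f x) @[h --> (0 : R)^'] --> d.
Proof.
split=> [[df <-] //|fd].
by apply: DeriveDef; [apply/cvg_ex; exists d | exact: cvg_lim fd].
Qed.

(** Derivatives along e1 and e2 are derivatives of one variable on a slice, which
    makes the one-dimensional chain rule and mean value theorem available. *)
Lemma is_derive_e1P f p d :
  is_derive p e1 f d <-> is_derive p.1 1 (fun t => f (t, p.2)) d.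
Proof.
rewrite !is_derive_cvgP.
suff -> : (fun h : R => h^-1 *: (f (h *: e1 + p) - f p)) =
  (fun h => h^-1 *: (f (h *: 1 + p.1, p.2) - f (p.1, p.2))) by [].
apply/funext => h; case: p => x y /=; do 2 f_equal; f_equal.
by congr (_, _); rewrite /= /GRing.scale/= /GRing.scale/= mulr0 add0r.
Qed.

Lemma is_derive_e2P f p d :
  is_derive p e2 f d <-> is_derive p.2 1 (fun t => f (p.1, t)) d.
Proof.
rewrite !is_derive_cvgP.
suff -> : (fun h : R => h^-1 *: (f (h *: e2 + p) - f p)) =
  (fun h => h^-1 *: (f (p.1, h *: 1 + p.2) - f (p.1, p.2))) by [].
apply/funext => h; case: p => x y /=; do 2 f_equal; f_equal.
by congr (_, _); rewrite /= /GRing.scale/= /GRing.scale/= mulr0 add0r.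
Qed.

Lemma continuous_fst2 : continuous (fst : R * R -> R).
Proof. by move=> p; exact: cvg_fst. Qed.

Lemma continuous_snd2 : continuous (snd : R * R -> R).
Proof. by move=> p; exact: cvg_snd. Qed.

Lemma is_derive_pairP (g : R * R -> R * R) p v d :
  is_derive p v g d <->
  is_derive p v (fst \o g) d.1 /\ is_derive p v (snd \o g) d.2.
Proof.
case: d => d1 d2; rewrite !is_derive_cvgP; split=> [gd|[gd1 gd2]].
  by split; [exact: (continuous_cvg _ (@continuous_fst2 (d1, d2)) gd)
            |exact: (continuous_cvg _ (@continuous_snd2 (d1, d2)) gd)].
exact: (cvg_pair gd1 gd2).
Qed.

(** Continuity of f is part of the definition because products need it: it
    follows from the other clauses only through the mean value theorem, see
    [C1_partials_square]. *)
Definition C1_partials f f1 f2 : Prop :=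
  [/\ continuous f, continuous f1, continuous f2,
      forall p, is_derive p e1 f (f1 p) & forall p, is_derive p e2 f (f2 p)].

Lemma C1_partials_cst k : C1_partials (fun=> k) (fun=> 0) (fun=> 0).
Proof. by split; do ?[exact: cst_continuous | move=> p; exact: is_derive_cst]. Qed.

Lemma C1_partials_fst : C1_partials fst (fun=> 1) (fun=> 0).
Proof.
split; do ?exact: cst_continuous; first by move=> p; exact: cvg_fst.
  by move=> p; apply/is_derive_e1P; exact: is_derive_id.
by move=> p; apply/is_derive_e2P; exact: is_derive_cst.
Qed.

Lemma C1_partials_snd : C1_partials snd (fun=> 0) (fun=> 1).
Proof.
split; do ?exact: cst_continuous; first by move=> p; exact: cvg_snd.
  by move=> p; apply/is_derive_e1P; exact: is_derive_cst.
by move=> p; apply/is_derive_e2P; exact: is_derive_id.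
Qed.

Let continuous_add f g :
  continuous f -> continuous g -> continuous (fun p => f p + g p).
Proof. by move=> cf cg p; apply: continuousD; [exact: cf|exact: cg]. Qed.

Let continuous_mul f g :
  continuous f -> continuous g -> continuous (fun p => f p * g p).
Proof. by move=> cf cg p; apply: continuousM; [exact: cf|exact: cg]. Qed.

Lemma C1_partialsD f f1 f2 g g1 g2 :
  C1_partials f f1 f2 -> C1_partials g g1 g2 ->
  C1_partials (fun p => f p + g p) (fun p => f1 p + g1 p) (fun p => f2 p + g2 p).
Proof.
move=> [cf cf1 cf2 df1 df2] [cg cg1 cg2 dg1 dg2].
by split; do ?[exact: continuous_add]; move=> p; exact: is_deriveD.
Qed.

Lemma C1_partialsM f f1 f2 g g1 g2 :
  C1_partials f f1 f2 -> C1_partials g g1 g2 ->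
  C1_partials (fun p => f p * g p) (fun p => f p * g1 p + g p * f1 p)
    (fun p => f p * g2 p + g p * f2 p).
Proof.
move=> [cf cf1 cf2 df1 df2] [cg cg1 cg2 dg1 dg2].
split; do ?[exact: continuous_mul |
  by apply: continuous_add; exact: continuous_mul];
  by move=> p; exact: is_deriveM.
Qed.

Lemma C1_partials_comp (u u' : R -> R) f f1 f2 :
  continuous u -> continuous u' -> (forall t : R, is_derive t 1 u (u' t)) ->
  C1_partials f f1 f2 ->
  C1_partials (u \o f) (fun p => u' (f p) * f1 p) (fun p => u' (f p) * f2 p).
Proof.
move=> cu cu' du [cf cf1 cf2 df1 df2].
have cc w : continuous w -> continuous (fun p => u' (f p) * w p).
  move=> cw p; apply: continuousM; last exact: cw.
  by apply: (continuous_comp (cf p)); exact: cu'.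
split; do ?exact: cc.
- by move=> p; apply: (continuous_comp (cf p)); exact: cu.
- move=> p; apply/is_derive_e1P.
  have /is_derive_e1P df := df1 p.
  by apply: (is_derive1_comp _ df); case: p {df}.
- move=> p; apply/is_derive_e2P.
  have /is_derive_e2P df := df2 p.
  by apply: (is_derive1_comp _ df); case: p {df}.
Qed.

End partials.

(** * The divergence theorem for fields of compact support *)

Section divergence_theorem.
Context {R : realType}.
Implicit Types (f g : R * R -> R) (p : R * R).

Lemma bounded_derivative_lipschitz (u u' : R -> R) (C : R) :
  (forall t : R, is_derive t 1 u (u' t)) -> (forall t, `|u' t| <= C) ->
  forall a b, `|u b - u a| <= C * `|b - a|.
Proof.
move=> du uC; suff H a b : a <= b -> `|u b - u a| <= C * `|b - a|.
  move=> a b; have [/H //|/ltW/H] := leP a b.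
  by rewrite distrC (distrC a).
move=> ab; have [|c _ ->] := @MVT_segment R u u' a b ab (fun t _ => du t).
  apply: continuous_subspaceT => t; apply: differentiable_continuous.
  by apply/derivable1_diffP; case: (du t).
by rewrite normrM ler_wpM2r.
Qed.

Lemma off_square_nbhs (M : R) p : ~ square M p -> \near p, ~ square M p.
Proof.
suff : open (~` square M) by move=> oM pM; exact: (open_nbhs_nbhs (conj oM pM)).
rewrite openC squareE.
have -> : forall A : set R, A `*` A = fst @^-1` A `&` snd @^-1` A by [].
apply: closedI; apply: closed_comp; do ?exact: itv_closed.
  by move=> q _; exact: continuous_fst2.
by move=> q _; exact: continuous_snd2.
Qed.

Lemma is_derive_off_square (M : R) f p v d : (forall q, ~ square M q -> f q = 0) ->
  is_derive p v f d -> ~ square M p -> d = 0.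
Proof.
move=> f0 [_ <-] /off_square_nbhs pM.
rewrite (@near_eq_derive _ _ _ f (cst 0)) ?derive_cst//.
by near=> q; apply: f0; near: q.
Unshelve. all: by end_near. Qed.

(** Outside the square f vanishes, so both partial derivatives are bounded and f
    is Lipschitz along each axis. *)
Lemma C1_partials_square (M : R) f f1 f2 : continuous f1 -> continuous f2 ->
  (forall p, is_derive p e1 f (f1 p)) -> (forall p, is_derive p e2 f (f2 p)) ->
  (forall p, ~ square M p -> f p = 0) -> C1_partials f f1 f2.
Proof.
move=> cf1 cf2 df1 df2 f0; split=> //.
have [_ [C1 f1C]] : bounded_measurable f1.
  apply: (bounded_measurable_continuous (M := M)) => // p.
  exact: is_derive_off_square.
have [_ [C2 f2C]] : bounded_measurable f2.
  apply: (bounded_measurable_continuous (M := M)) => // p.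
  exact: is_derive_off_square.
have fC p q : `|f p - f q| <= (C1 + C2) * `|p - q|.
  have -> : f p - f q =
      (f (p.1, p.2) - f (q.1, p.2)) + (f (q.1, p.2) - f (q.1, q.2)).
    by case: p q => ? ? [? ?] /=; rewrite subrKA.
  rewrite mulrDl (le_trans (ler_normD _ _))// lerD//.
    apply: (@le_trans _ _ (C1 * `|p.1 - q.1|)).
      apply: (@bounded_derivative_lipschitz (fun t => f (t, p.2))
        (fun t => f1 (t, p.2))).
        by move=> t; have /is_derive_e1P := df1 (t, p.2).
      by move=> t; apply: (f1C _).1.
    rewrite ler_wpM2l//; first by rewrite (le_trans _ (f1C 0).1).
    by rewrite prod_normE le_max lexx.
  apply: (@le_trans _ _ (C2 * `|p.2 - q.2|)).
    apply: (@bounded_derivative_lipschitz (fun t => f (q.1, t))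
      (fun t => f2 (q.1, t))).
      by move=> t; have /is_derive_e2P := df2 (q.1, t).
    by move=> t; apply: (f2C _).1.
  rewrite ler_wpM2l//; first by rewrite (le_trans _ (f2C 0).1).
  by rewrite prod_normE le_max lexx orbT.
move=> p; apply/cvgrPdist_le => e e0.
have C0 : 0 < C1 + C2 + 1.
  by rewrite ltr_wpDl// addr_ge0// ?(le_trans _ (f1C 0).1) ?(le_trans _ (f2C 0).1).
near=> q; rewrite (le_trans (fC _ _))//.
apply: (@le_trans _ _ ((C1 + C2 + 1) * `|p - q|)).
  by rewrite ler_wpM2r// lerDl.
rewrite mulrC -ler_pdivlMr//; near: q; apply: cvgr_dist_le => //.
by rewrite divr_gt0.
Unshelve. all: by end_near. Qed.

(** The interval is enlarged by 1 so that u vanishes at both ends. *)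
Lemma integral_derivative_eq0 (u u' : R -> R) (M : R) : continuous u' ->
  (forall t : R, is_derive t 1 u (u' t)) ->
  (forall t, ~ (`|t| <= M) -> u t = 0 /\ u' t = 0) ->
  (\int[@lebesgue_measure R]_t (u' t)%:E = 0)%E.
Proof.
move=> cu' du u0; set N : R := `|M| + 1.
have MN : M < N by rewrite ltr_pwDr// ler_norm.
have N0 : 0 < N by rewrite ltr_wpDl.
transitivity (\int[@lebesgue_measure R]_(t in `[(- N)%R, N]) (u' t)%:E)%E.
  rewrite [RHS]integral_mkcond; apply: eq_integral => t _; rewrite patchE.
  case: ifPn => //; rewrite notin_setE/= in_itv/= -ler_norml => tN.
  by rewrite (u0 t _).2// => tM; apply: tN; exact: (le_trans tM (ltW MN)).
have cu : continuous u.
  move=> t; apply: differentiable_continuous.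
  by apply/derivable1_diffP; case: (du t).
rewrite (@continuous_FTC2 _ u' u).
- by rewrite !(u0 _ _).1 ?subee// ?normrN gtr0_norm//; apply/negP; rewrite -ltNge.
- by rewrite (lt_trans _ N0)// oppr_lt0.
- exact: continuous_subspaceT.
- split.
  + by move=> t _; case: (du t).
  + exact/cvg_at_right_filter/cu.
  + exact/cvg_at_left_filter/cu.
- by move=> t _; rewrite derive1E; case: (du t).
Qed.

(** By Fubini, integrating first in the direction of the derivative. *)
Lemma int2_partial_eq0 (M : R) f f1 f2 : C1_partials f f1 f2 ->
  (forall p, ~ square M p -> f p = 0) ->
  [/\ bounded_measurable f1, bounded_measurable f2, int2 f1 = 0 & int2 f2 = 0].
Proof.
move=> [cf cf1 cf2 df1 df2] f0.
have f10 p : ~ square M p -> f1 p = 0 by exact: is_derive_off_square.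
have f20 p : ~ square M p -> f2 p = 0 by exact: is_derive_off_square.
have bf1 := bounded_measurable_continuous cf1 f10.
have bf2 := bounded_measurable_continuous cf2 f20.
have cpair1 (y : R) : continuous (fun t : R => (t, y) : R * R).
  move=> t; exact: (@cvg_pair _ _ _ (nbhs t) (nbhs t) (nbhs y) _ _ _
    id (cst y) cvg_id (cvg_cst y)).
have cpair2 (x : R) : continuous (fun t : R => (x, t) : R * R).
  move=> t; exact: (@cvg_pair _ _ _ (nbhs t) (nbhs x) (nbhs t) _ _ _
    (cst x) id (cvg_cst x) cvg_id).
split=> //; apply/eqP; rewrite -eqe -int2_EFin//; apply/eqP.
  have /integral21_prod_meas1 <- := bounded_measurable_integrable bf1.
  apply: integral0_eq => y _.
  apply: (@integral_derivative_eq0 (fun t => f (t, y)) (fun t => f1 (t, y)) M).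
  - by move=> t; apply: (continuous_comp (cpair1 y t)); exact: cf1.
  - by move=> t; have /is_derive_e1P := df1 (t, y).
  - by move=> t tM; split; [apply: f0|apply: f10] => -[].
have /integral12_prod_meas1 <- := bounded_measurable_integrable bf2.
apply: integral0_eq => x _.
apply: (@integral_derivative_eq0 (fun t => f (x, t)) (fun t => f2 (x, t)) M).
- by move=> t; apply: (continuous_comp (cpair2 x t)); exact: cf2.
- by move=> t; have /is_derive_e2P := df2 (x, t).
- by move=> t tM; split; [apply: f0|apply: f20] => -[].
Qed.

(** The fields over which the perimeter is a supremum. *)
Definition test_field (g : R * R -> R * R) : Prop :=
  [/\ C1 g, compactly_supported g & forall p, enorm (g p) <= 1].

Lemma compactly_supported_square (g : R * R -> R * R) : compactly_supported g ->
  exists M : R, forall p, ~ square M p -> g p = 0.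
Proof.
move=> [K /compact_bounded[M [_ KM]] g0].
exists (M + 1) => p pM; apply: g0 => /(KM (M + 1)).
rewrite ltrDl ltr01 => /(_ isT); rewrite /= prod_normE ge_max => /andP[p1 p2].
exact: pM.
Qed.

Lemma square_compactly_supported (g : R * R -> R * R) (M : R) :
  (forall p, ~ square M p -> g p = 0) -> compactly_supported g.
Proof.
move=> g0; exists (square M) => //.
by rewrite squareE; apply: compact_setX; exact: segment_compact.
Qed.

Lemma C1_components (g : R * R -> R * R) : C1 g -> compactly_supported g ->
  C1_partials (fun p => (g p).1) (fun p => ('D_e1 g p).1) (fun p => ('D_e2 g p).1) /\
  C1_partials (fun p => (g p).2) (fun p => ('D_e1 g p).2) (fun p => ('D_e2 g p).2).
Proof.
move=> [dg1 dg2 cg1 cg2] /compactly_supported_square[M g0].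
have gd1 p : is_derive p e1 g ('D_e1 g p) by apply: derivableP.
have gd2 p : is_derive p e2 g ('D_e2 g p) by apply: derivableP.
split; apply: (@C1_partials_square M).
- by move=> p; apply: (continuous_comp (cg1 p)); exact: continuous_fst2.
- by move=> p; apply: (continuous_comp (cg2 p)); exact: continuous_fst2.
- by move=> p; have /is_derive_pairP[] := gd1 p.
- by move=> p; have /is_derive_pairP[] := gd2 p.
- by move=> p /g0 ->.
- by move=> p; apply: (continuous_comp (cg1 p)); exact: continuous_snd2.
- by move=> p; apply: (continuous_comp (cg2 p)); exact: continuous_snd2.
- by move=> p; have /is_derive_pairP[] := gd1 p.
- by move=> p; have /is_derive_pairP[] := gd2 p.
- by move=> p /g0 ->.
Qed.

Lemma components_C1 (a a1 a2 b b1 b2 : R * R -> R) :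
  C1_partials a a1 a2 -> C1_partials b b1 b2 ->
  C1 (fun p => (a p, b p)) /\
  divergence (fun p => (a p, b p)) = (fun p => a1 p + b2 p).
Proof.
move=> [_ ca1 ca2 da1 da2] [_ cb1 cb2 db1 db2].
have d1 p : is_derive p e1 (fun p => (a p, b p)) (a1 p, b1 p).
  by apply/is_derive_pairP.
have d2 p : is_derive p e2 (fun p => (a p, b p)) (a2 p, b2 p).
  by apply/is_derive_pairP.
have E1 p : 'D_e1 (fun p => (a p, b p)) p = (a1 p, b1 p) by case: (d1 p).
have E2 p : 'D_e2 (fun p => (a p, b p)) p = (a2 p, b2 p) by case: (d2 p).
split; last by apply/funext => p; rewrite /divergence E1 E2.
split; [by move=> p; case: (d1 p)|by move=> p; case: (d2 p)| |].
- by rewrite (funext E1) => p; exact: (cvg_pair (ca1 p) (cb1 p)).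
- by rewrite (funext E2) => p; exact: (cvg_pair (ca2 p) (cb2 p)).
Qed.

Lemma test_field_divergence (g : R * R -> R * R) : test_field g ->
  bounded_measurable (divergence g) /\ int2 (divergence g) = 0.
Proof.
move=> [g1 cg _]; have [d1 d2] := C1_components g1 cg.
have [M g0] := compactly_supported_square cg.
have [|b1 _ i1 _] := int2_partial_eq0 (M := M) d1; first by move=> p /g0 ->.
have [|_ b2 _ i2] := int2_partial_eq0 (M := M) d2; first by move=> p /g0 ->.
by split; [exact: bounded_measurableD|rewrite int2D// i1 i2 addr0].
Qed.

End divergence_theorem.

(** * A cutoff function of class C1 *)

Section cutoff.
Context {R : realType}.
Variable k : R.
Hypothesis k0 : 0 < k.

Definition pos (t : R) : R := Num.max 0 t.

Lemma pos_ge0 t : 0 <= pos t.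
Proof. by rewrite le_max lexx. Qed.

Lemma pos_eq0 t : t <= 0 -> pos t = 0.
Proof. by move=> t0; rewrite /pos max_l. Qed.

Lemma pos_id t : 0 <= t -> pos t = t.
Proof. by move=> t0; rewrite /pos max_r. Qed.

Lemma continuous_pos : continuous pos.
Proof. by move=> t; apply: continuous_max; [exact: cvg_cst|exact: cvg_id]. Qed.

Lemma is_derive_pos_sqr (t : R) : is_derive t 1 (fun s => pos s ^+ 2) (2 * pos t).
Proof.
have sqr : is_derive t 1 (fun s : R => s ^+ 2) (2 * t).
  by apply: is_derive_eq; rewrite /GRing.scale/= mulr1 -mulr2n mulr_natl.
have [t0|t0|t0] := ltgtP t 0.
- rewrite pos_eq0 ?mulr0 ?ltW//.
  have /near_eq_is_derive : \near t, (fun=> 0 : R) t = pos t ^+ 2.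
    near=> s; rewrite pos_eq0 ?expr0n//; apply/ltW; near: s.
    exact: lt_nbhsl.
  by apply; exact: is_derive_cst.
- rewrite pos_id ?ltW//.
  have /near_eq_is_derive : \near t, (fun s : R => s ^+ 2) t = pos t ^+ 2.
    near=> s; rewrite pos_id//; apply/ltW; near: s; exact: lt_nbhsr.
  exact.
- rewrite t0 pos_eq0// mulr0; apply/is_derive_cvgP/cvgrPdist_le => e e0.
  near=> h.
  have he : `|h| <= e by near: h; apply: dnbhs0_le.
  rewrite distrC subr0 addr0 (pos_eq0 (lexx _)) expr0n/= subr0.
  rewrite [h%:A]mulr1 -[_ *: _]/(h^-1 * pos h ^+ 2).
  have [h0|h0] := leP h 0; first by rewrite pos_eq0// expr0n/= mulr0 normr0 ltW.
  by rewrite (pos_id (ltW h0)) expr2 mulKf ?gt_eqF.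
Unshelve. all: by end_near. Qed.

(** As k tends to 0 this C1 function tends to the indicator of t > 0, and
    [ramp'_sqr_le] bounds its derivative in the only form that matters: the
    error made by the calibration vanishes to second order at the boundary. *)
Definition ramp (t : R) : R := pos t ^+ 2 * (pos t ^+ 2 + k ^+ 2)^-1.

Definition ramp' (t : R) : R :=
  2 * pos t * k ^+ 2 * ((pos t ^+ 2 + k ^+ 2) ^+ 2)^-1.

Let den_gt0 t : 0 < pos t ^+ 2 + k ^+ 2.
Proof. by rewrite ltr_wpDl ?sqr_ge0// exprn_gt0. Qed.

Lemma is_derive_ramp (t : R) : is_derive t 1 ramp (ramp' t).
Proof.
have d1 := is_derive_pos_sqr t.
have d2 : is_derive t 1 (fun s => pos s ^+ 2 + k ^+ 2) (2 * pos t).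
  by apply: is_derive_eq; rewrite addr0.
have nz : pos t ^+ 2 + k ^+ 2 != 0 by rewrite gt_eqF.
have d3 : is_derive t 1 (fun s => (pos s ^+ 2 + k ^+ 2)^-1)
  (- (pos t ^+ 2 + k ^+ 2) ^- 2 *: (2 * pos t)).
  apply: DeriveDef; first by apply: derivableV => //; case: d2.
  by rewrite deriveV//; case: d2 => _ ->.
apply: is_derive_eq; rewrite /ramp' /GRing.scale/=.
by field.
Qed.

Lemma continuous_ramp : continuous ramp.
Proof.
move=> t; apply: differentiable_continuous; apply/derivable1_diffP.
by case: (is_derive_ramp t).
Qed.

Lemma continuous_ramp' : continuous ramp'.
Proof.
have cp := continuous_pos.
move=> t; apply: cvgM.
  by apply: cvgM; [apply: cvgM; [exact: cvg_cst|exact: cp]|exact: cvg_cst].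
apply: cvgV; first by rewrite gt_eqF// exprn_gt0.
have cden : pos s ^+ 2 + k ^+ 2 @[s --> t] --> pos t ^+ 2 + k ^+ 2.
  rewrite expr2; under eq_fun do rewrite expr2.
  by apply: cvgD; [apply: cvgM; exact: cp|exact: cvg_cst].
rewrite [X in _ --> X]expr2; under eq_fun do rewrite expr2.
exact: (cvgM cden cden).
Qed.

Lemma ramp_ge0 t : 0 <= ramp t.
Proof. by rewrite divr_ge0// ?sqr_ge0// ltW. Qed.

Lemma ramp_le1 t : ramp t <= 1.
Proof. by rewrite ler_pdivrMr// mul1r lerDl sqr_ge0. Qed.

Lemma ramp_eq0 t : t <= 0 -> ramp t = 0.
Proof. by move=> t0; rewrite /ramp pos_eq0// expr0n mul0r. Qed.

Lemma ramp'_eq0 t : t <= 0 -> ramp' t = 0.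
Proof. by move=> t0; rewrite /ramp' pos_eq0// mulr0 !mul0r. Qed.

Lemma ramp'_ge0 t : 0 <= ramp' t.
Proof.
by rewrite /ramp' divr_ge0 ?sqr_ge0// mulr_ge0 ?sqr_ge0// mulr_ge0// pos_ge0.
Qed.

(** With t > 0 the claim is 2 t^3 k <= (t^2 + k^2)^2, a consequence of
    2 t k <= t^2 + k^2 and t^2 <= t^2 + k^2. *)
Lemma ramp'_sqr_le t : ramp' t * t ^+ 2 <= k.
Proof.
have [t0|t0] := leP t 0; first by rewrite ramp'_eq0// mul0r ltW.
rewrite /ramp' (pos_id (ltW t0)).
rewrite [leLHS]mulrAC ler_pdivrMr; last first.
  by rewrite exprn_gt0// ltr_wpDl ?sqr_ge0// exprn_gt0.
rewrite -subr_ge0.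
have -> : k * (t ^+ 2 + k ^+ 2) ^+ 2 - 2 * t * k ^+ 2 * t ^+ 2 =
  k * (t ^+ 2 * (t - k) ^+ 2 + k ^+ 2 * (t ^+ 2 + k ^+ 2)) by ring.
rewrite mulr_ge0 ?ltW// ltr_wpDl//.
  by rewrite mulr_ge0// sqr_ge0.
by rewrite mulr_gt0 ?exprn_gt0// ltr_wpDl ?sqr_ge0// exprn_gt0.
Qed.

End cutoff.

Section ramp_limit.
Context {R : realType}.

Lemma cvg_ramp (t : R) : 0 < t -> ramp n.+1%:R^-1 t @[n --> \oo] --> (1 : R).
Proof.
move=> t0; rewrite /ramp pos_id ?ltW//.
have t2 : t ^+ 2 != 0 by rewrite gt_eqF// exprn_gt0.
have h : t ^+ 2 * (t ^+ 2 + n.+1%:R^-1 ^+ 2)^-1 @[n --> \oo] -->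
    t ^+ 2 * (t ^+ 2 + 0 ^+ 2 : R)^-1.
  apply: cvgM; first exact: cvg_cst.
  apply: cvgV; first by rewrite expr0n addr0.
  apply: cvgD; first exact: cvg_cst.
  by under eq_fun do rewrite expr2; apply: cvgM; exact: cvg_harmonic.
by move: h; rewrite expr0n addr0 divff.
Qed.

End ramp_limit.

(** * Calibrating a disc *)

Section calibration_algebra.
Context {K : realFieldType}.
Implicit Types (a b x y u w r D f : K).

(** Here and in [calibration_normal] u = |x|^2 / r^2 and X = x (3 - u) / (2 r), so that
    |X|^2 = u (3 - u)^2 / 4 = 1 - (1 - u)^2 (4 - u) / 4. *)
Lemma calibration_le1 x y u r : 0 < r -> x ^+ 2 + y ^+ 2 = u * r ^+ 2 ->
  u <= 1 ->
  (x * ((3 - u) / (2 * r))) ^+ 2 + (y * ((3 - u) / (2 * r))) ^+ 2 <= 1.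
Proof.
move=> r0 xyu u1.
have -> : (x * ((3 - u) / (2 * r))) ^+ 2 + (y * ((3 - u) / (2 * r))) ^+ 2 =
    (x ^+ 2 + y ^+ 2) * ((3 - u) / (2 * r)) ^+ 2 by ring.
have -> : (x ^+ 2 + y ^+ 2) * ((3 - u) / (2 * r)) ^+ 2 =
    1 - (1 - u) ^+ 2 * (4 - u) / 4.
  by rewrite xyu; field; rewrite gt_eqF.
rewrite gerBl divr_ge0// mulr_ge0 ?sqr_ge0//; lra.
Qed.

(** X is normal to the circle u = 1 up to second order: since |g| <= 1,
    2 x . g <= |x|^2 / r + r = r (u + 1), whereas 2 x . X = r u (3 - u), and the
    difference is r (1 - u)^2. *)
Lemma calibration_normal x y u r a b : 0 < r ->
  x ^+ 2 + y ^+ 2 = u * r ^+ 2 -> a ^+ 2 + b ^+ 2 <= 1 ->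
  x * (a - x * ((3 - u) / (2 * r))) + y * (b - y * ((3 - u) / (2 * r))) <=
    r / 2 * (1 - u) ^+ 2.
Proof.
move=> r0 xyu ab1; rewrite -(ler_pM2l (_ : 0 < 2 * r)) ?mulr_gt0//.
have -> : 2 * r * (r / 2 * (1 - u) ^+ 2) = r ^+ 2 * (1 - u) ^+ 2 by field.
have -> : 2 * r * (x * (a - x * ((3 - u) / (2 * r))) +
    y * (b - y * ((3 - u) / (2 * r)))) =
    2 * r * (x * a + y * b) - (x ^+ 2 + y ^+ 2) * (3 - u).
  by field; rewrite gt_eqF.
have : 0 <= (x - r * a) ^+ 2 + (y - r * b) ^+ 2 by rewrite addr_ge0// sqr_ge0.
have : r ^+ 2 * (a ^+ 2 + b ^+ 2) <= r ^+ 2 * 1.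
  by rewrite ler_wpM2l// sqr_ge0.
rewrite xyu; move: xyu; lra.
Qed.

Lemma sqr_convex f a b : 0 <= f <= 1 ->
  (a + f * (b - a)) ^+ 2 <= (1 - f) * a ^+ 2 + f * b ^+ 2.
Proof.
move=> /andP[f0 f1]; rewrite -subr_ge0.
have -> : (1 - f) * a ^+ 2 + f * b ^+ 2 - (a + f * (b - a)) ^+ 2 =
  f * (1 - f) * (b - a) ^+ 2 by ring.
by rewrite mulr_ge0 ?sqr_ge0// mulr_ge0// subr_ge0.
Qed.

(** The product rule for g + f (X - g), whose left-hand side has the shape that
    the rules of differentiation produce; D stands for the derivative of the
    cutoff with respect to 1 - u. *)
Lemma glued_divergence f D x y w a b da db r : r != 0 ->
  da + (f * (x * (- x / r ^+ 3) + w * (1 + 0) + (-1 * da + a * 0)) +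
    (x * w + -1 * a) * (- (D * (2 / r ^+ 2)) * x)) +
  (db + (f * (y * (- y / r ^+ 3) + w * (1 + 0) + (-1 * db + b * 0)) +
    (y * w + -1 * b) * (- (D * (2 / r ^+ 2)) * y))) - (da + db) =
  f * (2 * w - (x ^+ 2 + y ^+ 2) / r ^+ 3 - (da + db)) +
  D * (2 / r ^+ 2) * (x * (a - x * w) + y * (b - y * w)).
Proof. by move=> r0; field. Qed.

(** The integrand inequality behind the addition of a disc.  The booleans i and b
    say whether the point is in F and in the disc, f is the cutoff, s the
    divergence of X, and dg, dG are the divergences of g and of the glued
    field.  In F both sides equal dg; outside F the divergence of g cancels. *)
Lemma glued_pointwise (i b : bool) (f s k e dg dG : K) : 0 <= k ->
  0 <= f <= 1 -> (~~ b -> f = 0) -> (b -> ~~ i -> s <= k) ->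
  dG - dg <= f * (s - dg) + (if b then e else 0) ->
  i%:R * dg + (f * dg - i%:R * (f * dg)) <=
  i%:R * dG - (dG - dg) + (k + e) * (b%:R - i%:R * b%:R).
Proof.
move=> k0 /andP[f0 f1]; case: i => [_ _ _|].
  by rewrite !mul1r !subrr mulr0 !addr0 opprB addrC subrK.
rewrite !mul0r add0r !subr0 sub0r.
case: b => [_ /(_ isT isT) sk dG_le|/(_ isT) -> _].
  have := ler_wpM2l f0 sk; have := ler_wpM2r k0 f1.
  by rewrite mulr1; move: dG_le; lra.
by rewrite !mul0r mulr0; lra.
Qed.

End calibration_algebra.

Section adding_a_ball.
Context {R : realType}.
Implicit Types (F : set (R * R)) (c x p : R * R).

Definition sqdist c p : R := (p.1 - c.1) ^+ 2 + (p.2 - c.2) ^+ 2.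

Lemma sqdist_square (r : R) c p : 0 < r -> sqdist c p < r ^+ 2 ->
  square (`|c.1| + `|c.2| + r) p.
Proof.
move=> r0 pc.
have abs_le (a b : R) : (a - b) ^+ 2 < r ^+ 2 -> `|a| <= `|b| + r.
  move=> ab; have : `|a - b| < r.
    by rewrite -ltr_sqr ?nnegrE ?(ltW r0)// real_normK ?num_real.
  have := ler_normD (a - b) b; rewrite subrK; lra.
have := normr_ge0 c.1; have := normr_ge0 c.2.
have /abs_le : (p.1 - c.1) ^+ 2 < r ^+ 2.
  by rewrite (le_lt_trans _ pc)// lerDl sqr_ge0.
have /abs_le : (p.2 - c.2) ^+ 2 < r ^+ 2.
  by rewrite (le_lt_trans _ pc)// lerDr sqr_ge0.
by move=> *; split; lra.
Qed.

Lemma eballP (r : R) c p : 0 < r -> eball c r p <-> sqdist c p < r ^+ 2.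
Proof.
move=> r0; rewrite -(@ltr_sqrt _ _ (r ^+ 2)) ?exprn_gt0//.
by rewrite sqrtr_sqr gtr0_norm.
Qed.

Lemma enorm_le1P p : enorm p <= 1 <-> p.1 ^+ 2 + p.2 ^+ 2 <= 1.
Proof. by rewrite /enorm -{1}(@sqrtr1 R) ler_sqrt. Qed.

Lemma C1_partials_sqdist c : C1_partials (sqdist c)
  (fun p => 2 * (p.1 - c.1)) (fun p => 2 * (p.2 - c.2)).
Proof.
have cx := C1_partialsD C1_partials_fst (C1_partials_cst (- c.1)).
have cy := C1_partialsD C1_partials_snd (C1_partials_cst (- c.2)).
have := C1_partialsD (C1_partialsM cx cx) (C1_partialsM cy cy).
by congr C1_partials; apply/funext => p; rewrite /sqdist /=; ring.
Qed.

(** The inequality P(F) <= A + c |F|, with the supremum defining P unfolded.  The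
    constant A makes it possible to enlarge the slope c slightly: a bound with
    slope h for F0 is a bound with slope c and A = (h - c) |F0|, see
    [perimeter_bound_path]. *)
Definition perimeter_bound (A c : R) F : Prop :=
  forall g, test_field g -> int2 (fun p => \1_F p * divergence g p) <=
    A + c * int2 \1_F.

Section glued_field.
Variables (c : R * R) (r k : R).
Hypotheses (r0 : 0 < r) (k0 : 0 < k).

Let u p := sqdist c p / r ^+ 2.
Let phi p := ramp k (1 - u p).
Let w p := (3 - u p) / (2 * r).

(** (1 - phi) g + phi X. *)
Definition glue (g : R * R -> R * R) p : R * R :=
  ((g p).1 + phi p * ((p.1 - c.1) * w p - (g p).1),
   (g p).2 + phi p * ((p.2 - c.2) * w p - (g p).2)).

Let rn0 : r != 0. Proof. by rewrite gt_eqF. Qed.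

Let u_partials : C1_partials u
  (fun p => 2 * (p.1 - c.1) / r ^+ 2) (fun p => 2 * (p.2 - c.2) / r ^+ 2).
Proof.
have := C1_partialsM (C1_partials_cst (r ^- 2)) (C1_partials_sqdist c).
by congr C1_partials; apply/funext => p; rewrite /u; field.
Qed.

Let phi_partials : C1_partials phi
  (fun p => - (ramp' k (1 - u p) * (2 / r ^+ 2)) * (p.1 - c.1))
  (fun p => - (ramp' k (1 - u p) * (2 / r ^+ 2)) * (p.2 - c.2)).
Proof.
have v_partials := C1_partialsD (C1_partials_cst 1)
  (C1_partialsM (C1_partials_cst (-1)) u_partials).
have := C1_partials_comp (continuous_ramp k0) (continuous_ramp' k0)
  (is_derive_ramp k0) v_partials.
by congr C1_partials; apply/funext => p /=; rewrite ?mulN1r// /phi; field.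
Qed.

Let w_partials : C1_partials w
  (fun p => - (p.1 - c.1) / r ^+ 3) (fun p => - (p.2 - c.2) / r ^+ 3).
Proof.
have := C1_partialsM (C1_partials_cst (2 * r)^-1)
  (C1_partialsD (C1_partials_cst 3)
    (C1_partialsM (C1_partials_cst (-1)) u_partials)).
by congr C1_partials; apply/funext => p /=; rewrite /w; field.
Qed.

(** The field is admissible because (1 - phi) g + phi X is a convex combination
    of vectors of norm at most 1 in the disc and equals g elsewhere.  In its
    divergence the term with the gradient of phi is controlled by
    [calibration_normal] and [ramp'_sqr_le]. *)
Lemma glue_spec g : test_field g -> test_field (glue g) /\
   forall p, divergence (glue g) p - divergence g p <=
     phi p * (3 / r - 2 * u p / r - divergence g p) +
     (if u p < 1 then k / r else 0).
Proof.
move=> [g1 cg gle1]; have [a b] := C1_components g1 cg.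
have cx := C1_partialsD C1_partials_fst (C1_partials_cst (- c.1)).
have cy := C1_partialsD C1_partials_snd (C1_partials_cst (- c.2)).
have Ga := C1_partialsD a (C1_partialsM phi_partials
  (C1_partialsD (C1_partialsM cx w_partials)
    (C1_partialsM (C1_partials_cst (-1)) a))).
have Gb := C1_partialsD b (C1_partialsM phi_partials
  (C1_partialsD (C1_partialsM cy w_partials)
    (C1_partialsM (C1_partials_cst (-1)) b))).
have [GC1 Gdiv] := components_C1 Ga Gb.
have GE : glue g =
    (fun p => ((g p).1 + phi p * ((p.1 + - c.1) * w p + -1 * (g p).1),
               (g p).2 + phi p * ((p.2 + - c.2) * w p + -1 * (g p).2))).
  by apply/funext => p; rewrite /glue !mulN1r.
rewrite -GE in GC1 Gdiv.
have uE p : (p.1 - c.1) ^+ 2 + (p.2 - c.2) ^+ 2 = u p * r ^+ 2.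
  by rewrite /u divfK// expf_neq0.
split; last first.
  move=> p; rewrite Gdiv /divergence glued_divergence// uE.
  have -> : 2 * w p - u p * r ^+ 2 / r ^+ 3 = 3 / r - 2 * u p / r.
    by rewrite /w; field.
  rewrite lerD2l; case: ltP => [u1|u1]; last first.
    by rewrite ramp'_eq0 ?subr_le0// !mul0r.
  have /enorm_le1P/(calibration_normal r0 (uE p)) := gle1 p.
  have D0 := ramp'_ge0 k (1 - u p).
  move/(ler_wpM2l (mulr_ge0 D0 (divr_ge0 (ler0n R 2) (sqr_ge0 r)))).
  move=> /le_trans; apply.
  have scale (D v : R) :
    D * (2 / r ^+ 2) * (r / 2 * v ^+ 2) = D * v ^+ 2 / r by field.
  rewrite scale.
  by rewrite ler_wpM2r ?invr_ge0 ?(ltW r0)//; exact: ramp'_sqr_le.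
split => //.
  have [M gM] := compactly_supported_square cg.
  pose N := Num.max M (`|c.1| + `|c.2| + r).
  apply: (@square_compactly_supported _ _ N) => p pM.
  have gp0 : g p = 0.
    by apply: gM => -[p1 p2]; apply: pM; split; rewrite le_max (p1, p2).
  rewrite /glue gp0 /phi ramp_eq0 ?mul0r ?addr0// subr_le0.
  rewrite ler_pdivlMr ?exprn_gt0// mul1r leNgt; apply/negP => pc; apply: pM.
  have [p1 p2] := sqdist_square r0 pc.
  by split; rewrite le_max (p1, p2) orbT.
move=> p; apply/enorm_le1P.
have /enorm_le1P g1le := gle1 p.
rewrite /glue /=; set x := p.1 - c.1; set y := p.2 - c.2.
have f0 := ramp_ge0 k0 (1 - u p); have f1 := ramp_le1 k0 (1 - u p).
have [u1|u1] := ltP (u p) 1; last first.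
  by rewrite /phi ramp_eq0 ?subr_le0// !mul0r !addr0.
have X_le1 := calibration_le1 r0 (uE p) (ltW u1).
have f01 : 0 <= phi p <= 1 by rewrite f0.
apply: (le_trans (lerD (sqr_convex _ _ f01) (sqr_convex _ _ f01))).
rewrite -/(phi p) in f0 f1 *.
have := ler_wpM2l f0 X_le1; rewrite -subr_ge0 in f1.
have := ler_wpM2l f1 g1le; rewrite -/(w p) -/x -/y.
move: (phi p) (x * w p) (y * w p) (g p).1 (g p).2 => *; lra.
Qed.

End glued_field.
End adding_a_ball.

(** * Adding a disc to a set *)

Section adding_balls.
Context {R : realType}.
Implicit Types (F : set (R * R)) (c x p : R * R).

Lemma continuous_sqdist c : continuous (sqdist c).
Proof. by have [] := C1_partials_sqdist c. Qed.

Lemma eball_sqdist (r : R) c : 0 < r -> eball c r = [set p | sqdist c p < r ^+ 2].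
Proof. by move=> r0; apply/seteqP; split=> p /(eballP _ _ r0). Qed.

Lemma open_eball (r : R) c : 0 < r -> open (eball c r).
Proof.
move=> r0; rewrite eball_sqdist//.
have /continuousP/(_ _ (@open_lt R (r ^+ 2))) := @continuous_sqdist c.
by [].
Qed.

Lemma indicU (A B : set (R * R)) p :
  \1_(A `|` B) p = \1_A p + (\1_B p - \1_A p * \1_B p) :> R.
Proof.
rewrite !indicE in_setU; case: (p \in A); case: (p \in B) => /=; lra.
Qed.

(** The condition on the part of the disc outside F says that the divergence of
    the calibrating field X is at most k there. *)
Lemma perimeter_bound_add_ball (A k M r : R) F c :
  0 < r -> 0 <= k -> borel2 F -> F `<=` square M ->
  (forall p, sqdist c p < r ^+ 2 -> ~ F p ->
     3 / r - 2 * (sqdist c p / r ^+ 2) / r <= k) ->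
  perimeter_bound A k F -> perimeter_bound A k (F `|` eball c r).
Proof.
move=> r0 k0 mF FM dX FA g tg.
have [bg ig] := test_field_divergence tg.
have bF : bounded_measurable (\1_F : R * R -> R).
  exact: bounded_measurable_indic FM.
have bB : bounded_measurable (\1_(eball c r) : R * R -> R).
  apply: (@bounded_measurable_indic _ _ (`|c.1| + `|c.2| + r)).
    by apply: open_borel2; exact: open_eball.
  by move=> p /(eballP _ _ r0); exact: sqdist_square.
pose u p := sqdist c p / r ^+ 2.
have uB p : \1_(eball c r) p = (u p < 1)%R%:R :> R.
  rewrite indicE /u ltr_pdivrMr ?exprn_gt0// mul1r; congr ((nat_of_bool _)%:R).
  apply/idP/idP; first by rewrite inE => /(eballP _ _ r0).
  by move=> pc; rewrite inE; apply/(eballP _ _ r0).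
pose e n : R := n.+1%:R^-1.
have e0 n : 0 < e n by rewrite invr_gt0.
pose phi n p := ramp (e n) (1 - u p).
have phi01 n p : 0 <= phi n p <= 1 by rewrite ramp_ge0// ramp_le1.
have phi0 n p : ~~ (u p < 1) -> phi n p = 0.
  by rewrite -leNgt => u1; rewrite /phi ramp_eq0 ?subr_le0.
have bphi n : bounded_measurable (phi n).
  apply: (@bounded_measurable_continuous _ _ (`|c.1| + `|c.2| + r)).
    move=> p; apply: (@continuous_comp _ _ _ (fun p => 1 - u p)); last first.
      exact: continuous_ramp.
    apply: cvgB; first exact: cvg_cst.
    by apply: cvgM; [exact: continuous_sqdist|exact: cvg_cst].
  move=> p pM; apply: phi0; apply/negP => u1; apply: pM.
  apply: sqdist_square => //.
  by move: u1; rewrite /u ltr_pdivrMr ?exprn_gt0// mul1r.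
pose f n p := \1_F p * divergence g p +
  (phi n p * divergence g p - \1_F p * (phi n p * divergence g p)).
have bf n : bounded_measurable (f n).
  have bfg : bounded_measurable (fun p => phi n p * divergence g p).
    exact: bounded_measurableM.
  apply: bounded_measurableD; first exact: bounded_measurableM.
  by apply: bounded_measurableB => //; exact: bounded_measurableM.
have bm : bounded_measurable
    (fun p => \1_(eball c r) p - \1_F p * \1_(eball c r) p : R).
  by apply: bounded_measurableB => //; exact: bounded_measurableM.
set m := int2 (fun p => \1_(eball c r) p - \1_F p * \1_(eball c r) p : R).
have int_f n : int2 (f n) <= A + k * int2 \1_F + (k + e n / r) * m.
  have [G tG divG] : exists2 G, test_field G & forall p,
      divergence G p - divergence g p <=
      phi n p * (3 / r - 2 * u p / r - divergence g p) +
      (if u p < 1 then e n / r else 0).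
    have [tG divG] := glue_spec c r0 (e0 n) tg.
    by exists (glue c r (e n) g).
  have [bG iG] := test_field_divergence tG.
  have FAG := FA _ tG.
  have bFG : bounded_measurable (fun p => \1_F p * divergence G p).
    exact: bounded_measurableM.
  have bdiff : bounded_measurable (fun p => divergence G p - divergence g p).
    exact: bounded_measurableB.
  have b1 : bounded_measurable (fun p => \1_F p * divergence G p -
    (divergence G p - divergence g p)) by exact: bounded_measurableB.
  have b2 : bounded_measurable (fun p => (k + e n / r) *
    (\1_(eball c r) p - \1_F p * \1_(eball c r) p)) by exact: bounded_measurableZ.
  have flux0 : int2 (fun p => divergence G p - divergence g p) = 0.
    exact: etrans (int2B bG bg)
      (etrans (congr2 (fun a b => a - b) iG ig) (subrr 0)).
  have := le_int2 (bf n) (bounded_measurableD b1 b2).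
  rewrite (int2D b1 b2) (int2B bFG bdiff) flux0 subr0 (int2Z _ bm) -/m => le_f.
  apply: (le_trans (le_f _)); last by rewrite lerD2r.
  move=> p; rewrite /f uB indicE.
  apply: (glued_pointwise (s := 3 / r - 2 * u p / r) k0 (phi01 n p)).
  - exact: phi0.
  - rewrite ltr_pdivrMr ?exprn_gt0// mul1r => pc /negP pF.
    by apply: dX pc _ => Fp; apply: pF; rewrite inE.
  - exact: divG.
(* The cutoffs converge to the indicator of the disc, so the left-hand side of
   [int_f] converges to the integral of div g over the union. *)
set f_lim := fun p => \1_(F `|` eball c r) p * divergence g p.
have f_limE p : f_lim p = \1_F p * divergence g p +
    (\1_(eball c r) p - \1_F p * \1_(eball c r) p) * divergence g p.
  by rewrite /f_lim indicU mulrDl.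
have bf_lim : bounded_measurable f_lim.
  rewrite (funext f_limE); apply: bounded_measurableD; exact: bounded_measurableM.
have cvg_f : int2 (f n) @[n --> \oo] --> int2 f_lim.
  apply: (cvg_int2 (g := fun p => `|divergence g p|)) => //.
  - exact: bounded_measurable_norm.
  - move=> n p; rewrite /f indicE; have /andP[f0 f1] := phi01 n p.
    case: (p \in F); first by rewrite !mul1r subrr addr0.
    by rewrite !mul0r add0r subr0 normrM ger0_norm// ler_piMl.
  - move=> p; rewrite f_limE /f uB.
    apply: cvgD; first exact: cvg_cst.
    have -> : ((u p < 1)%R%:R - \1_F p * (u p < 1)%R%:R) * divergence g p =
      (u p < 1)%R%:R * divergence g p - \1_F p * ((u p < 1)%R%:R * divergence g p).
      by ring.
    have cvg_phi : phi n p @[n --> \oo] --> ((u p < 1)%R%:R : R).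
      case: ltP => u1; first by apply: cvg_ramp; rewrite subr_gt0.
      under eq_fun do rewrite phi0 -?leNgt//.
      exact: cvg_cst.
    apply: cvgB; [|apply: cvgM; first exact: cvg_cst];
      by apply: cvgM => //; exact: cvg_cst.
have cvg_bound : A + k * int2 \1_F + (k + e n / r) * m @[n --> \oo] -->
    A + k * int2 \1_F + (k + 0 / r) * m.
  apply: cvgD; first exact: cvg_cst.
  apply: cvgM; last exact: cvg_cst.
  apply: cvgD; first exact: cvg_cst.
  by apply: cvgM; [exact: cvg_harmonic|exact: cvg_cst].
have : int2 f_lim <= A + k * int2 \1_F + (k + 0 / r) * m.
  by apply: (ler_cvg_to cvg_f cvg_bound); exact: nearW.
rewrite mul0r addr0; move=> /le_trans; apply.
have -> : (\1_(F `|` eball c r) : R * R -> R) =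
  (fun p => \1_F p + (\1_(eball c r) p - \1_F p * \1_(eball c r) p)).
  by apply/funext => p; exact: indicU.
by rewrite int2D// -/m mulrDr addrA.
Qed.

End adding_balls.

(** * Rolling a disc along a path *)

Section rolling.
Context {R : realType}.
Implicit Types (F : set (R * R)) (c x p : R * R).

Lemma sqdistC c p : sqdist c p = sqdist p c.
Proof. by rewrite /sqdist; ring. Qed.

Lemma le_abs_of_sqr (a r : R) : 0 <= r -> a ^+ 2 <= r ^+ 2 -> `|a| <= r.
Proof.
by move=> r0 ar; rewrite -ler_sqr ?nnegrE// real_normK ?num_real.
Qed.

(** A bound for the divergence of the calibrating field in the layer left
    uncovered when a disc of radius r is moved by d. *)
Definition slope (r d : R) : R := r^-1 + (8 * r * d + 4 * d ^+ 2) / r ^+ 3.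

(** Writing x = p - c' and a = c' - c, one has
    r^2 - |x|^2 <= |x + a|^2 - |x|^2 = 2 x . a + |a|^2, where each coordinate of x
    is at most r and each coordinate of a at most d. *)
Lemma rolled_divergence (r d : R) c c' p : 0 < r -> `|c' - c| <= d ->
  sqdist c' p < r ^+ 2 -> r ^+ 2 <= sqdist c p ->
  3 / r - 2 * (sqdist c' p / r ^+ 2) / r <= slope r d.
Proof.
move=> r0; rewrite prod_normE ge_max /= => /andP[a_le b_le] c'p cp.
set a := c'.1 - c.1 in a_le; set b := c'.2 - c.2 in b_le.
set x := p.1 - c'.1; set y := p.2 - c'.2.
have x_le : `|x| <= r.
  apply: le_abs_of_sqr (ltW r0) _.
  by rewrite (le_trans _ (ltW c'p))// lerDl sqr_ge0.
have y_le : `|y| <= r.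
  apply: le_abs_of_sqr (ltW r0) _.
  by rewrite (le_trans _ (ltW c'p))// lerDr sqr_ge0.
have cross (s t : R) : `|s| <= r -> `|t| <= d -> s * t <= r * d.
  by move=> sr td; rewrite (le_trans (ler_norm _))// normrM ler_pM.
have sqr_le (t : R) : `|t| <= d -> t ^+ 2 <= d ^+ 2.
  move=> td; rewrite -[t ^+ 2]ger0_norm ?sqr_ge0// normrX.
  by rewrite ler_pXn2r// nnegrE (le_trans _ td).
have gap : r ^+ 2 - sqdist c' p <= 4 * r * d + 2 * d ^+ 2.
  have -> : sqdist c' p = sqdist c p - 2 * (x * a + y * b) - (a ^+ 2 + b ^+ 2).
    by rewrite /sqdist /x /y /a /b; ring.
  have := cross _ _ x_le a_le; have := cross _ _ y_le b_le.
  have := sqr_le _ a_le; have := sqr_le _ b_le; move: cp; lra.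
have -> : 3 / r - 2 * (sqdist c' p / r ^+ 2) / r =
    r^-1 + 2 * (r ^+ 2 - sqdist c' p) / r ^+ 3 by field; rewrite gt_eqF.
rewrite lerD2l ler_pM2r ?invr_gt0 ?exprn_gt0//.
by move: gap; lra.
Qed.

Definition rolled F (r : R) (cs : nat -> R * R) (n : nat) : set (R * R) :=
  F `|` [set p | exists2 i, (i <= n)%N & eball (cs i) r p].

Lemma borel2_rolled (r : R) F (cs : nat -> R * R) (n : nat) :
  0 < r -> borel2 F -> borel2 (rolled F r cs n).
Proof.
move=> r0 mF; apply: measurableU => //; apply: open_borel2.
suff -> : [set p | exists2 i, (i <= n)%N & eball (cs i) r p] =
    \bigcup_(i in [set i | (i <= n)%N]) eball (cs i) r.
  by apply: bigcup_open => i _; exact: open_eball.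
by apply/seteqP; split=> p [i i_n pi]; exists i.
Qed.

(** Each disc is added to a set that already contains the preceding one, so
    [rolled_divergence] applies at every step with the same slope. *)
Lemma perimeter_bound_roll (A d M r : R) F (cs : nat -> R * R) (n : nat) :
  0 < r -> 0 <= d -> borel2 F -> F `<=` square M ->
  (forall i, (i <= n)%N -> eball (cs i) r `<=` square M) ->
  (forall i, (i < n)%N -> `|cs i.+1 - cs i| <= d) ->
  eball (cs 0%N) r `<=` F ->
  perimeter_bound A (slope r d) F ->
  perimeter_bound A (slope r d) (rolled F r cs n).
Proof.
move=> r0 d0 mF FM; elim: n => [|n IHn] csM cs_d cs0 FA.
  suff -> : rolled F r cs 0 = F by [].
  apply/seteqP; split=> [p [//|[i]]|p]; last by left.
  by rewrite leqn0 => /eqP ->; exact: cs0.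
have An : perimeter_bound A (slope r d) (rolled F r cs n).
  by apply: IHn => // i /leqW; [exact: csM|exact: cs_d].
have -> : rolled F r cs n.+1 = rolled F r cs n `|` eball (cs n.+1) r.
  apply/seteqP; split=> p.
    case=> [Fp|[i]]; first by left; left.
    rewrite leq_eqVlt => /predU1P[->|i_n pi]; first by right.
    by left; right; exists i.
  case=> [[Fp|[i i_n pi]]|pn]; first by left.
    by right; exists i => //; exact: leqW.
  by right; exists n.+1.
have slope0 : 0 <= slope r d.
  by rewrite addr_ge0 ?invr_ge0 ?(ltW r0)// divr_ge0 ?exprn_ge0 ?(ltW r0)//
     addr_ge0// mulr_ge0 ?sqr_ge0// mulr_ge0// ltW.
apply: (perimeter_bound_add_ball (M := M)) => //; first exact: borel2_rolled.
  move=> p [/FM //|[i i_n]]; apply: csM; exact: leqW.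
move=> p pn Fp; apply: (rolled_divergence (c := cs n)) => //.
  exact: cs_d.
rewrite leNgt; apply/negP => /(eballP _ _ r0) pn'; apply: Fp; right.
by exists n.
Qed.

(** Heine's theorem, by the near-covering form of compactness. *)
Lemma within_continuous_uniform (V : normedModType R) (eta : R -> V) :
  {within `[0, 1], continuous eta} -> forall d : R, 0 < d ->
  exists2 e : R, 0 < e & forall s t, s \in `[0, 1] -> t \in `[0, 1] ->
    `|s - t| < e -> `|eta s - eta t| <= d.
Proof.
move=> /subspace_continuousP ceta d d0.
have /compact_near_coveringP/(_ R 0^'+ (fun e s => s \in `[0, 1] ->
  forall t, t \in `[0, 1] -> `|s - t| < e -> `|eta s - eta t| <= d)) :
  compact `[0, 1 : R] by exact: segment_compact.
case=> [x x01|].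
  have : \forall y \near within `[0, 1] (nbhs x), `|eta x - eta y| <= d / 2.
    by apply: cvgr_dist_le; [exact: ceta|rewrite divr_gt0].
  rewrite near_withinE => /nbhs_ballP[/= a a0 xa].
  near=> s e => /= s01 t t01 st.
  have sx : `|x - s| < a / 2 by near: s; apply: cvgr_dist_lt; rewrite ?divr_gt0.
  have ea : e < a / 2 by near: e; apply: nbhs_right_lt; rewrite divr_gt0.
  have xs : `|eta x - eta s| <= d / 2.
    by apply: xa => //; rewrite /ball/= (lt_trans sx)//; lra.
  have xt : `|eta x - eta t| <= d / 2.
    apply: xa => //; rewrite /ball/=.
    by have := ler_distD s x t; lra.
  have := ler_distD (eta x) (eta s) (eta t); rewrite (distrC (eta s) (eta x)); lra.
move=> a /= a0 near_a; have a2 : 0 < a / 2 by rewrite divr_gt0.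
exists (a / 2) => // s t s01; apply: near_a => //.
by rewrite /= sub0r normrN gtr0_norm//; lra.
Unshelve. all: by end_near. Qed.

(** The discs centred at the points i / (n + 1) of the path approximate T from
    inside.  Their bound exceeds the bound with slope 1 / r by at most
    (slope r d - 1 / r) |T|, with d the mesh of the subdivision. *)
Lemma perimeter_bound_path (M r : R) F (eta : R -> R * R) :
  0 < r -> borel2 F -> F `<=` square M ->
  {within `[0, 1], continuous eta} ->
  (forall s, s \in `[0, 1] -> eball (eta s) r `<=` square M) ->
  eball (eta 0) r `<=` F ->
  perimeter_bound 0 r^-1 F ->
  let T := F `|` [set p | exists2 s, s \in `[0, 1] & eball (eta s) r p] in
  borel2 T /\ perimeter_bound 0 r^-1 T.
Proof.
move=> r0 mF FM ceta etaM eta0 Fbound T.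
have unif := within_continuous_uniform ceta.
have TM : T `<=` square M by move=> p [/FM //|[s s01]]; exact: etaM.
have mT : borel2 T.
  apply: measurableU => //; apply: open_borel2.
  suff -> : [set p | exists2 s, s \in `[0, 1] & eball (eta s) r p] =
    \bigcup_(s in `[0, 1]) eball (eta s) r.
    by apply: bigcup_open => s _; exact: open_eball.
  by apply/seteqP; split=> p [s s01 ps]; exists s.
split=> // g tg; rewrite add0r.
have [bg _] := test_field_divergence tg.
have bT := bounded_measurable_indic mT TM.
have bF := bounded_measurable_indic mF FM.
pose cs n i : R * R := eta (i%:R / n.+1%:R).
pose Fn n := rolled F r (cs n) n.+1.
have frac01 n i : (i <= n.+1)%N -> i%:R / n.+1%:R \in `[0, 1 : R].
  move=> i_n; rewrite in_itv/= divr_ge0//=.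
  by rewrite ler_pdivrMr// mul1r ler_nat.
have FnT n : Fn n `<=` T.
  move=> p [Fp|[i i_n pi]]; [by left|right; exists (i%:R / n.+1%:R) => //].
  exact: frac01.
have harmonic_lt (e : R) : 0 < e -> \forall n \near \oo, n.+1%:R^-1 < e.
  move=> e0; near=> n; have : `|n.+1%:R^-1 : R| < e.
    by near: n; apply: cvgr0_norm_lt => //; exact: cvg_harmonic.
  by rewrite gtr0_norm ?invr_gt0.
have mesh (d : R) : 0 < d -> \forall n \near \oo, forall i, (i < n.+1)%N ->
    `|cs n i.+1 - cs n i| <= d.
  move=> /unif[e e0 He]; near=> n => i i_n; apply: He; rewrite ?frac01// 1?ltnW//.
  rewrite -mulrBl -natrB ?leqnSn// subSnn mul1r gtr0_norm ?invr_gt0//.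
  by near: n; exact: harmonic_lt.
have bFn n : bounded_measurable (\1_(Fn n) : R * R -> R).
  apply: (bounded_measurable_indic (M := M)); first exact: borel2_rolled.
  by move=> p /FnT/TM.
have le_indic (A B : set (R * R)) p : A `<=` B -> \1_A p <= \1_B p :> R.
  move=> AB; rewrite !indicE; case: (boolP (p \in A)) => // pA.
  by rewrite mem_set//; apply: AB; rewrite inE in pA.
pose m : R := int2 \1_T.
have m0 : 0 <= m by apply: Rintegral_ge0 => p _; rewrite indicE.
(* The step d is chosen so that (8 r d + 4 d^2) m / r^3 <= e, using d^2 <= d. *)
have key (e : R) : 0 < e -> \forall n \near \oo,
    int2 (fun p => \1_(Fn n) p * divergence g p) <= r^-1 * m + e.
  move=> e0; pose d := Num.min 1 (e * r ^+ 3 / ((8 * r + 4) * (m + 1))).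
  have D0 : 0 < (8 * r + 4) * (m + 1).
    by rewrite mulr_gt0// ?ltr_wpDl// mulr_ge0// ltW.
  have d0 : 0 < d by rewrite lt_min ltr01 divr_gt0// mulr_gt0// exprn_gt0.
  have excess_le : (slope r d - r^-1) * m <= e.
    have d1 : d <= 1 by rewrite ge_min lexx.
    have : d <= e * r ^+ 3 / ((8 * r + 4) * (m + 1)) by rewrite ge_min lexx orbT.
    rewrite ler_pdivlMr// => dD.
    rewrite /slope [_ + _ - _]addrAC subrr add0r mulrAC.
    rewrite ler_pdivrMr ?exprn_gt0//; apply: le_trans dD.
    have dd : d ^+ 2 <= d by rewrite expr2 ler_piMl// ltW.
    have -> : d * ((8 * r + 4) * (m + 1)) = (8 * r * d + 4 * d) * (m + 1) by ring.
    apply: ler_pM => //; [|by lra|by lra].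
    by rewrite addr_ge0 ?mulr_ge0 ?sqr_ge0 ?(ltW r0) ?(ltW d0).
  have slope_ge : r^-1 <= slope r d.
    rewrite lerDl divr_ge0 ?exprn_ge0 ?(ltW r0)//.
    by rewrite addr_ge0 ?mulr_ge0 ?sqr_ge0 ?(ltW r0) ?(ltW d0).
  near=> n.
  have Fn_bound : perimeter_bound
      ((r^-1 - slope r d) * int2 \1_F) (slope r d) (Fn n).
    apply: (perimeter_bound_roll (M := M)) => //; first exact: ltW.
    - by move=> i i_n; apply: etaM; exact: frac01.
    - by near: n; exact: mesh.
    - by rewrite /cs mul0r.
    - by move=> g' tg'; rewrite -mulrDl subrK; have := Fbound _ tg'; rewrite add0r.
  have Fnm : int2 \1_(Fn n) <= m.
    by apply: le_int2 => // p; exact/le_indic/FnT.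
  have F0 : 0 <= int2 \1_F by apply: Rintegral_ge0 => p _; rewrite indicE.
  apply: (le_trans (Fn_bound _ tg)); move: excess_le.
  have slope0 : 0 <= slope r d by rewrite (le_trans _ slope_ge)// invr_ge0 ltW.
  have := ler_wpM2l slope0 Fnm.
  have := mulr_ge0 (_ : 0 <= slope r d - r^-1) F0; rewrite subr_ge0.
  move=> /(_ slope_ge); rewrite !mulrBl; lra.
(* An open disc that contains p still contains it when its centre moves to a
   nearby point of the subdivision. *)
have near_Fn p : T p -> \forall n \near \oo, Fn n p.
  case=> [Fp|[s s01 /(eballP _ _ r0) ps]]; first by apply: nearW => n; left.
  have : nbhs (eta s) [set c | sqdist c p < r ^+ 2].
    apply: open_nbhs_nbhs; split => //.
    have -> : [set c | sqdist c p < r ^+ 2] = eball p r.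
      by rewrite eball_sqdist//; apply/seteqP; split=> c /=; rewrite sqdistC.
    exact: open_eball.
  move=> /nbhs_ballP[a /= a0 ball_a].
  have [e e0 He] := unif (a / 2) (divr_gt0 a0 (ltr0n R 2)).
  near=> n; right.
  have n0 : 0 < n.+1%:R :> R by [].
  have /andP[s0 s1] : 0 <= s <= 1 by rewrite in_itv/= in s01.
  have := truncn_itv (mulr_ge0 s0 (ltW n0)).
  set i := Num.trunc _ => /andP[i_le i_gt].
  have i_n : (i <= n.+1)%N.
    by rewrite -(ler_nat R) (le_trans i_le)// ler_piMl// ltW.
  exists i => //; apply/eballP => //; apply: ball_a.
  have : `|eta s - cs n i| <= a / 2.
    apply: He => //; first exact: frac01.
    apply: (@lt_trans _ _ n.+1%:R^-1); last by near: n; exact: harmonic_lt.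
    have -> : s - i%:R / n.+1%:R = (s * n.+1%:R - i%:R) / n.+1%:R.
      by rewrite mulrBl mulfK// gt_eqF.
    rewrite ger0_norm ?divr_ge0 ?subr_ge0 ?(ltW n0)//.
    rewrite ltr_pdivrMr// mulVf ?gt_eqF// ltrBlDr addrC.
    by rewrite natr1.
  by rewrite -ball_normE => /le_lt_trans; apply; lra.
have lim : int2 (fun p => \1_(Fn n) p * divergence g p) @[n --> \oo] -->
    int2 (fun p => \1_T p * divergence g p).
  apply: (cvg_int2 (g := fun p => `|divergence g p|)) => //.
  - by move=> n; exact: bounded_measurableM.
  - exact: bounded_measurable_norm.
  - exact: bounded_measurableM.
  - move=> n p; rewrite indicE normrM.
    by case: (_ \in _); rewrite ?normr1 ?normr0 ?mul1r ?mul0r.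
  - move=> p; apply: cvgM; last exact: cvg_cst.
    have [Tp|Tp] := pselect (T p); last first.
      rewrite [X in _ --> X]indicE memNset//.
      have -> : (fun n => \1_(Fn n) p) = (fun=> 0 : R).
        by apply/funext => n; rewrite indicE memNset// => /FnT.
      exact: cvg_cst.
    rewrite [X in _ --> X]indicE mem_set//.
    apply: cvg_near_cst; near=> n.
    by rewrite indicE mem_set//; near: n; exact: near_Fn.
apply/ler_addgt0Pr => e e0.
by apply: (ler_cvg_to lim (cvg_cst _)); exact: key.
Unshelve. all: by end_near. Qed.

End rolling.

(** * Cheeger sets *)

Section cheeger.
Context {R : realType}.
Implicit Types (A B E F Omega : set (R * R)).

Lemma bounded_area_fin (M : R) F : borel2 F -> F `<=` square M ->
  area F \is a fin_num.
Proof.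
move=> mF FM; rewrite ge0_fin_numE//; apply: le_lt_trans (area_square M).
by apply: le_measure; rewrite ?inE//; exact: borel2_square.
Qed.

Lemma perimeter_boundP (M k : R) F : borel2 F -> F `<=` square M ->
  perimeter_bound 0 k F <-> (perimeter F <= k%:E * area F)%E.
Proof.
move=> mF FM; have bF := bounded_measurable_indic mF FM.
have areaF : area F = (int2 \1_F)%:E.
  by rewrite int2_indic// -ge0_fin_numE//; exact: bounded_area_fin FM.
rewrite areaF -EFinM; split=> [Fk|PF g tg].
  apply: ge_ereal_sup => _ [g tg <-].
  have [bg _] := test_field_divergence tg.
  by rewrite integral_int2// lee_fin -[leRHS]add0r; exact: Fk.
have [bg _] := test_field_divergence tg.
rewrite add0r -lee_fin -integral_int2//; apply: le_trans PF.
by apply: ereal_sup_ubound; exists g.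
Qed.

Lemma ae_eq_area A B : borel2 A -> borel2 B -> ae_subset A B -> ae_subset B A ->
  area A = area B.
Proof.
move=> mA mB AB BA.
have area_cap (C D : set (R * R)) : borel2 C -> borel2 D -> ae_subset C D ->
    area C = area (C `&` D).
  move=> mC mD CD; rewrite /area [LHS](measureDI _ mC mD).
  by rewrite [X in (X + _)%E]CD add0e.
by rewrite (area_cap _ _ mA mB AB) (area_cap _ _ mB mA BA) setIC.
Qed.

(** Fields are integrated over A and over B, and both integrals agree with the one
    over the intersection. *)
Lemma ae_eq_perimeter A B : borel2 A -> borel2 B -> ae_subset A B ->
  ae_subset B A -> perimeter A = perimeter B.
Proof.
move=> mA mB AB BA; congr ereal_sup.
suff integral_cap (C D : set (R * R)) (g : R * R -> R * R) :
    borel2 C -> borel2 D -> ae_subset C D -> test_field g ->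
    (\int[leb2 R]_(p in (C : set (mplane R))) (divergence g p)%:E =
     \int[leb2 R]_(p in (C `&` D : set (mplane R))) (divergence g p)%:E)%E.
  apply/seteqP; split=> _ [g tg <-]; exists g => //.
    by rewrite (integral_cap A B)// (integral_cap B A)// setIC.
  by rewrite (integral_cap A B)// (integral_cap B A)// setIC.
move=> mC mD CD tg; have [bg _] := test_field_divergence tg.
rewrite (@negligible_integral _ _ _ (leb2 R) (C : set (mplane R)) (C `\` D))
  ?setDD//.
- exact: measurableD.
- apply: integrableS (bounded_measurable_integrable bg) => //.
Qed.

Let ratio_le (x y z : \bar R) : (0 < y)%E -> y \is a fin_num ->
  (x / y <= z)%E = (x <= z * y)%E.
Proof.
by case: y => // a; rewrite lte_fin => a0 _; rewrite inver gt_eqF// lee_pdivrMr.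
Qed.

Lemma cheeger_set_of_perimeter_bound (M h : R) Omega F :
  cheeger_const Omega = h%:E -> Omega `<=` square M ->
  borel2 F -> F `<=` Omega -> (0 < area F)%E -> perimeter_bound 0 h F ->
  cheeger_set Omega F.
Proof.
move=> hE OmegaM mF FOmega F_gt0.
have FM : F `<=` square M by move=> p /FOmega /OmegaM.
move=> /(perimeter_boundP _ mF FM) PF.
have areaF := bounded_area_fin mF FM.
split=> //.
  rewrite /ae_subset /area (_ : F `\` Omega = set0) ?measure0//.
  by apply/seteqP; split=> // p [/FOmega].
apply/eqP; rewrite eq_le; apply/andP; split; last first.
  by apply: ereal_inf_lbound; exists F.
by rewrite hE ratio_le.
Qed.

Lemma perimeter_bound_of_cheeger_set (M h : R) Omega E F :
  cheeger_const Omega = h%:E -> Omega `<=` square M ->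
  cheeger_set Omega E -> borel2 F -> F `<=` Omega ->
  ae_subset E F -> ae_subset F E -> perimeter_bound 0 h F.
Proof.
move=> hE OmegaM [mE _ E_gt0 ratioE] mF FOmega EF FE.
have FM : F `<=` square M by move=> p /FOmega /OmegaM.
apply/(perimeter_boundP _ mF FM).
move: ratioE E_gt0; rewrite hE /cheeger_ratio.
rewrite (ae_eq_perimeter mE mF EF FE) (ae_eq_area mE mF EF FE).
have areaF := bounded_area_fin mF FM.
by move=> ratioF F_gt0; rewrite -ratio_le// ratioF.
Qed.

(** The difference quotient times s - t tends to 0. *)
Lemma derivable01_continuous (V : normedModType R) (f : R -> V) :
  (forall t : R, t \in `[0, 1] -> derivable01 f t) ->
  {within `[0, 1], continuous f}.
Proof.
move=> df; apply/subspace_continuousP => t t01.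
have /cvg_ex[/= l q_l] := df t t01.
have id_t : s - t @[s --> within `[0, 1] t^'] --> (0 : R).
  rewrite -(subrr t); apply: cvgB; last exact: cvg_cst.
  apply: cvg_trans (cvg_within _) _; exact: cvg_within.
have : (s - t) *: ((s - t)^-1 *: (f s - f t)) @[s --> within `[0, 1] t^']
    --> 0 *: l.
  exact: cvgZ.
rewrite scale0r => /cvgr0Pnorm_le f_t.
apply/cvgrPdist_le => e e0; have := f_t e e0.
rewrite !near_withinE; apply: filterS => s near_s s01 /=.
have [->|st] := eqVneq s t; first by rewrite subrr normr0 ltW.
have := near_s st s01; rewrite scalerA divff ?subr_eq0// scale1r.
by rewrite distrC.
Qed.

Lemma bounded_sub_square (A : set (R * R)) : bounded_set A ->
  exists M : R, A `<=` square M.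
Proof.
move=> [M [_ AM]]; exists (M + 1) => p /(AM (M + 1)).
by rewrite ltrDl ltr01 => /(_ isT); rewrite /= prod_normE ge_max => /andP[].
Qed.

Lemma eball_nonpos (x : R * R) (r : R) : r <= 0 -> eball x r = set0.
Proof.
move=> r0; apply/seteqP; split=> // p; rewrite /eball/= => pr.
by have := le_lt_trans (sqrtr_ge0 _) (lt_le_trans pr r0); rewrite ltxx.
Qed.

Lemma ae_subsetU (A B C : set (R * R)) : borel2 A -> borel2 B -> borel2 C ->
  ae_subset A C -> ae_subset B C -> ae_subset (A `|` B) C.
Proof.
move=> mA mB mC AC BC; rewrite /ae_subset /area setDUl.
apply/eqP; rewrite -measure_le0; apply: (le_trans (measureU2 _ _ _)).
- exact: measurableD.
- exact: measurableD.
- by rewrite [X in (X + _)%E]AC [X in (_ + X)%E]BC adde0.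
Qed.

Lemma subset_ae_subset (A B C : set (R * R)) : borel2 A -> borel2 B -> borel2 C ->
  A `<=` B -> ae_subset B C -> ae_subset A C.
Proof.
move=> mA mB mC AB BC; apply/eqP; rewrite -measure_le0 -BC; apply: le_measure.
- by rewrite inE; exact: measurableD.
- by rewrite inE; exact: measurableD.
- exact: setSD.
Qed.

Lemma continuous01_scale (V : normedModType R) (f : R -> V) (t : R) :
  t \in `[0, 1] -> {within `[0, 1], continuous f} ->
  {within `[0, 1], continuous (fun s => f (t * s))}.
Proof.
move=> t01 /subspace_continuousP cf; apply/subspace_continuousP => s s01.
have ts01 u : `[0, 1]%classic u -> `[0, 1]%classic (t * u).
  move: t01; rewrite /= !in_itv/= => /andP[t0 t1] /andP[u0 u1].
  by rewrite mulr_ge0//= mulr_ile1.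
move=> B fB; have near_B :
    nbhs s [set u | `[0, 1]%classic (t * u) -> B (f (t * u))].
  have fB' := cf _ (ts01 _ s01) _ fB.
  have scale_cont : continuous (fun u : R => t * u) by exact: mulrl_continuous.
  exact: (scale_cont s _ fB').
by apply: filterS near_B => u Bu /ts01; exact: Bu.
Qed.

End cheeger.

Unset Implicit Arguments.

Theorem lemma2p12 (R : realType) (Omega : set (R * R))
    (Omega_open : open Omega) (Omega_bounded : bounded_set Omega)
    (h r : R) (hE : h = fine (cheeger_const Omega)) (rE : r = h^-1)
    (E : set (R * R)) (E_max : maximal_cheeger_set Omega E)
    (x0 : R * R) (ball_E : ae_subset (eball x0 r) E)
    (gamma : R -> R * R)
    (gamma_in : forall t : R, t \in `[0, 1] -> Omega (gamma t))
    (gamma_C11 : C11_curve gamma) (gamma_reg : regular_curve gamma)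
    (gamma_curv : curvature_bounded_by gamma h)
    (gamma0 : gamma 0 = x0)
    (balls_Omega : forall t : R, t \in `[0, 1] -> eball (gamma t) r `<=` Omega) :
  forall t : R, t \in `[0, 1] -> ae_subset (eball (gamma t) r) E.
Proof.
move=> t t01.
(* A Cheeger constant equal to 0 or to +oo makes h = r = 0, and the discs are
   empty. *)
have [r_le0|r0] := leP r 0.
  rewrite /ae_subset eball_nonpos// set0D; exact: measure0.
have h0 : 0 < h by rewrite -invr_gt0 -rE.
have constE : cheeger_const Omega = h%:E.
  move: h0; rewrite hE; case: (cheeger_const Omega) => //=; rewrite ltxx//.
have [M OmegaM] := bounded_sub_square Omega_bounded.
have [E_cheeger E_contains] := E_max.
have [mE E_Omega E_gt0 _] := E_cheeger.
have mOmega := open_borel2 Omega_open.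
have in01 s : s \in `[0, 1] -> t * s \in `[0, 1].
  move: t01; rewrite !in_itv/= => /andP[t0 t1] /andP[s0 s1].
  by rewrite mulr_ge0//= mulr_ile1.
have zero01 : (0 : R) \in `[0, 1] by rewrite in_itv/= lexx ler01.
have one01 : (1 : R) \in `[0, 1] by rewrite in_itv/= lexx ler01.
pose B0 := eball x0 r.
have mB0 : borel2 B0 by apply: open_borel2; exact: open_eball.
have B0_Omega : B0 `<=` Omega by rewrite /B0 -gamma0; exact: balls_Omega.
(* A representative of E which is contained in Omega and contains the disc in the
   strict sense, not only up to null sets. *)
pose F := (E `&` Omega) `|` B0.
have mF : borel2 F by apply: measurableU => //; exact: measurableI.
have F_Omega : F `<=` Omega by move=> p [[]|/B0_Omega].
have FE : ae_subset F E.
  apply: ae_subsetU => //; first exact: measurableI.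
  apply: (@subset_ae_subset _ _ E) => //; first exact: measurableI.
  by rewrite /ae_subset /area setDv measure0.
have EF : ae_subset E F.
  apply/eqP; rewrite -measure_le0 -E_Omega; apply: le_measure.
  - by rewrite inE; exact: measurableD.
  - by rewrite inE; exact: measurableD.
  - by move=> p [Ep Fp]; split=> // Op; apply: Fp; left.
have F_bound :=
  perimeter_bound_of_cheeger_set constE OmegaM E_cheeger mF F_Omega EF FE.
have [|||||mT T_bound] :=
  @perimeter_bound_path _ M r F (fun s => gamma (t * s)) r0 mF.
- by move=> p /F_Omega /OmegaM.
- by apply: continuous01_scale => //; exact: (derivable01_continuous gamma_C11.1).
- by move=> s s01 p ps; apply: OmegaM; exact: (balls_Omega _ (in01 _ s01)).
- by rewrite mulr0 gamma0 => p; right.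
- by rewrite rE invrK.
set T := F `|` _ in mT T_bound.
have T_Omega : T `<=` Omega.
  by move=> p [/F_Omega //|[s s01]]; exact: (balls_Omega _ (in01 _ s01)).
have T_cheeger : cheeger_set Omega T.
  apply: (cheeger_set_of_perimeter_bound constE OmegaM) => //.
    rewrite (lt_le_trans E_gt0)// (ae_eq_area mE mF EF FE).
    by apply: le_measure; rewrite ?inE// => p; left.
  by move: T_bound; rewrite rE invrK.
apply: subset_ae_subset (E_contains _ T_cheeger) => //.
  by apply: open_borel2; exact: open_eball.
by move=> p pt; right; exists 1; rewrite ?mulr1.
Qed.
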